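(* Let $S^6\subset\mathbb{R}^7$ be the unit sphere with its standard round metric and Levi-Civita connection $\nabla$. There is no almost complex structure $J$ on $S^6$ which is strongly integrable with respect to $\nabla$; that is, there is no almost complex structure $J$ on $S^6$ such that $\nabla_{JX}J=J\,\nabla_XJ$ for all tangent vectors $X$.
   Context: An almost complex structure on a smooth manifold $M$ is a smooth section $J$ of $\operatorname{End}(TM)$ with $J^2=-\operatorname{Id}$. The connection $\nabla$ on the tangent bundle induces a connection on $\operatorname{End}(TM)$, also denoted $\nabla$, by $(\nabla_X J)Y=\nabla_X(JY)-J\nabla_XY$. For a torsion free connection $\nabla$ on $TM$, $J$ is called strongly integrable with respect to $\nabla$ if $\nabla_{JX}J=J\,\nabla_XJ$ for all vectors $X$. *)

(* Defs.v *)
From HB Require Import structures.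
From mathcomp Require Import all_boot all_order all_algebra.
From mathcomp Require Import all_classical all_reals all_analysis.
Set Implicit Arguments.
Unset Strict Implicit.
Unset Printing Implicit Defensive.
Import Order.TTheory GRing.Theory Num.Theory.
Import numFieldNormedType.Exports.
Local Open Scope classical_set_scope.
Local Open Scope ring_scope.

(** The library norm on 'rV[R]_n is the sup norm, so the Euclidean structure is
    given separately; the topology and differentiability are the same. *)
Definition dot (R : realType) (n : nat) (u v : 'rV[R]_n) : R :=
  \sum_i u 0 i * v 0 i.

(** The unit sphere S^n in R^(n+1). *)
Definition sphere (R : realType) (n : nat) : Type :=
  {x : 'rV[R]_n.+1 | dot x x == 1}.

Section Smooth.
Context {R : realType} {W : normedModType R}.

Definition iter_derive (V : normedModType R) (s : seq V) (F : V -> W) : V -> W :=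
  foldr (fun v G => 'D_v G) F s.

(** C^oo on U: every iterated directional derivative is (Frechet)
    differentiable, hence continuous, at every point of U. *)
Definition smooth_on (V : normedModType R) (U : set V) (F : V -> W) : Prop :=
  forall (s : seq V) (x : V), U x -> differentiable (iter_derive s F) x.

(** A map on the sphere is smooth when it is locally the restriction of a C^oo
    map defined on an open set of the ambient space. *)
Definition smooth (n : nat) (f : sphere R n -> W) : Prop :=
  forall p : sphere R n,
  exists (U : set 'rV[R]_n.+1) (F : 'rV[R]_n.+1 -> W),
    [/\ open U, U (val p), smooth_on U F
      & forall q : sphere R n, U (val q) -> F (val q) = f q].

Lemma north_subproof (n : nat) :
  dot (delta_mx 0 0 : 'rV[R]_n.+1) (delta_mx 0 0) == 1.
Proof.
rewrite /dot (bigD1 ord0) //= big1 => [|i /negPf i0].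
  by rewrite !mxE !eqxx mulr1 addr0.
by rewrite !mxE eqxx i0 mul0r.
Qed.

(** x |-> x / |x|, with an arbitrary value at the origin. *)
Definition radial (n : nat) (x : 'rV[R]_n.+1) : sphere R n :=
  insubd (exist (fun x => is_true (dot x x == 1)) _ (north_subproof n))
         ((Num.sqrt (dot x x))^-1 *: x).

(** The differential df_p(v): for v tangent at p, t |-> radial (p + t v) is a
    curve on the sphere through p with velocity v, and the right-hand side is by
    definition of 'D_v the derivative of f along this curve. *)
Definition sderive (n : nat) (f : sphere R n -> W) (p : sphere R n)
    (v : 'rV[R]_n.+1) : W :=
  'D_v (f \o @radial n) (val p).

End Smooth.

Section LeviCivita.
Context {R : realType} {n : nat}.
Local Notation S := (sphere R n).
Local Notation E := 'rV[R]_n.+1.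

Definition tangent (p : S) (v : E) : Prop := dot (val p) v = 0.

Definition vfield (X : S -> E) : Prop :=
  smooth X /\ forall p, tangent p (X p).

(** The Lie bracket in ambient coordinates: [X, Y] = DY(X) - DX(Y). *)
Definition bracket (X Y : S -> E) : S -> E :=
  fun p => sderive Y p (X p) - sderive X p (Y p).

(** Connections on TS^n: [nabla Y p v] stands for (nabla_v Y)(p), and is
    relevant only for Y a vector field and v in T_p S^n. *)
Record connection (nabla : (S -> E) -> S -> E -> E) : Prop := Connection {
  nabla_tangent : forall Y p v, vfield Y -> tangent p v ->
    tangent p (nabla Y p v);
  nabla_linear : forall Y p (a : R) u v, vfield Y -> tangent p u ->
    tangent p v -> nabla Y p (a *: u + v) = a *: nabla Y p u + nabla Y p v;
  nabla_smooth : forall X Y, vfield X -> vfield Y ->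
    smooth (fun p => nabla Y p (X p));
  nablaD : forall Y Z p v, vfield Y -> vfield Z -> tangent p v ->
    nabla (fun q => Y q + Z q) p v = nabla Y p v + nabla Z p v;
  nabla_leibniz : forall (f : S -> R) Y p v, smooth f -> vfield Y ->
    tangent p v ->
    nabla (fun q => f q *: Y q) p v = sderive f p v *: Y p + f p *: nabla Y p v
}.

Definition torsion_free (nabla : (S -> E) -> S -> E -> E) : Prop :=
  forall X Y p, vfield X -> vfield Y ->
  nabla Y p (X p) - nabla X p (Y p) = bracket X Y p.

(** Compatibility with the round metric, the restriction of [dot] to each
    tangent space. *)
Definition round_metric_compatible (nabla : (S -> E) -> S -> E -> E) : Prop :=
  forall Y Z p v, vfield Y -> vfield Z -> tangent p v ->
  sderive (fun q => dot (Y q) (Z q)) p v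
  = dot (nabla Y p v) (Z p) + dot (Y p) (nabla Z p v).

Definition levi_civita (nabla : (S -> E) -> S -> E -> E) : Prop :=
  [/\ connection nabla, torsion_free nabla & round_metric_compatible nabla].

(** An endomorphism of T_p S^n is encoded by the matrix A (acting on the right
    of row vectors) which extends it by 0 on the normal line R p; this realizes
    End(TS^n) as a smooth subbundle of the trivial bundle of square matrices. *)
Definition tangent_endo (p : S) (A : 'M[R]_n.+1) : Prop :=
  val p *m A = 0 /\ forall v, tangent p v -> tangent p (v *m A).

Definition almost_complex (J : S -> 'M[R]_n.+1) : Prop :=
  [/\ smooth J, forall p, tangent_endo p (J p)
    & forall p v, tangent p v -> v *m J p *m J p = - v].

(** (nabla_v J)(Y) at p. *)
Definition nabla_endo (nabla : (S -> E) -> S -> E -> E) (J : S -> 'M[R]_n.+1)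
    (p : S) (v : E) (Y : S -> E) : E :=
  nabla (fun q => Y q *m J q) p v - nabla Y p v *m J p.

(** nabla_{Jv} J = J nabla_v J for every tangent vector v, as endomorphisms
    evaluated on vector fields. *)
Definition strongly_integrable (nabla : (S -> E) -> S -> E -> E)
    (J : S -> 'M[R]_n.+1) : Prop :=
  forall p v Y, tangent p v -> vfield Y ->
  nabla_endo nabla J p (v *m J p) Y = nabla_endo nabla J p v Y *m J p.

End LeviCivita.

(* Main.v *)
Require Import Defs.
From mathcomp Require Import all_boot all_order all_algebra.
From mathcomp Require Import all_classical all_reals all_analysis.
From mathcomp Require Import ring lra.
Set Implicit Arguments.
Unset Strict Implicit.
Unset Printing Implicit Defensive.
Import Order.TTheory GRing.Theory Num.Theory.
Import numFieldNormedType.Exports.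
Local Open Scope classical_set_scope.
Local Open Scope ring_scope.

(** Why there is no strongly integrable [J] on the round six-sphere.

    In C^7 let W_p be the complex 4-space spanned by the unit vector p and by
    the vectors X + i JX with X tangent at p; modulo p it is the space of
    vectors of type (0,1).  The Levi-Civita connection is the tangential part of
    the flat derivative, so strong integrability says exactly that the map
    p |-> W_p into the Grassmannian of C^7 is holomorphic with respect to [J].
    The only real vectors of W_p are the multiples of p, so the map is an
    immersion, and it pulls the Kaehler form of the Grassmannian back to a
    symplectic form on S^6.  As H^2(S^6) = 0 such a form is exact, hence so is
    its cube, a volume form: a contradiction.

    The Grassmannian is replaced by projections.  C^7 is R^14, multiplication by
    i is the matrix [tw_I], and W_p is encoded by the orthogonal projection
    [twistor J p] onto its orthogonal complement.  For any family N of
    projections commuting with [tw_I] the form tr(I N d_uN d_vN) is closed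
    ([chern_form_closed]).  After [levi_civitaE] and
    [strongly_integrable_sderive] have turned the hypothesis into an identity on
    the derivative of [J], [tw_offdiag_J] says that the off-diagonal block of dN
    is complex linear, and [tw_offdiag_neq0] that it is injective; together they
    give [twistor_form_neq0], which is nondegeneracy.

    The topological step is done in a stereographic chart, where the closed form
    w on R^6 is O(|x|^-4).  On the slab [0, r^2] x [-r, r]^6 with coordinates
    (t, x), consider the closed 6-form obtained by wedging w translated by t in
    the first direction with w /\ w.  By Stokes its integrals over the faces
    cancel.  The face t = 0 contributes the integral of w /\ w /\ w, bounded
    away from 0, while the face t = r^2 and the lateral faces contribute O(1/r).
    Stokes is needed only in the form of a statement on Riemann sums
    ([discrete_divergence]), so that no integral occurs in the proof; the
    conclusion is [no_decaying_symplectic_form]. *)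

(** * Derivatives along lines and symmetry of second derivatives *)

Section Lines.
Context {R : realType} {V : normedModType R}.
Implicit Types (f : V -> R) (x u v : V).

Lemma is_derive_line f x v (s : R) :
  derivable f (x + s *: v) v ->
  is_derive s 1 (fun t : R => f (x + t *: v)) ('D_v f (x + s *: v)).
Proof.
move=> df.
have E : (fun h : R => h^-1 *: (((fun t : R => f (x + t *: v)) \o shift s) (h *: 1) -
       f (x + s *: v)))
  = (fun h : R => h^-1 *: ((f \o shift (x + s *: v)) (h *: v) - f (x + s *: v))).
  apply/funext => h /=; congr (_ *: (f _ - _)).
  by rewrite [h *: 1]mulr1 scalerDl addrCA.
split; first by rewrite /derivable E.
by rewrite /derive E.
Qed.

Lemma mvt_line f x v (h : R) : 0 < h ->
  (forall s : R, 0 <= s <= h -> derivable f (x + s *: v) v) ->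
  exists2 s : R, 0 < s < h & f (x + h *: v) - f x = h * 'D_v f (x + s *: v).
Proof.
move=> h0 df.
have [||c ch E] := @MVT R (fun t : R => f (x + t *: v)) (fun s => 'D_v f (x + s *: v)) 0 h h0.
- move=> s; rewrite in_itv /= => /andP[s0 sh].
  by apply: is_derive_line; apply: df; rewrite !ltW.
- apply: derivable_within_continuous => s; rewrite in_itv /= => sh.
  by have [] := @is_derive_line f x v s (df s sh).
exists c; first by rewrite in_itv in ch.
by move: E; rewrite scale0r addr0 subr0 => ->; rewrite mulrC.
Qed.

(** Two applications of the mean value theorem, first along [u], then along [v];
    the left-hand side is symmetric in [u] and [v]. *)
Lemma mixed_difference (U : set V) f x u v (h : R) : 0 < h ->
  (forall s t : R, 0 <= s <= h -> 0 <= t <= h -> U (x + s *: u + t *: v)) ->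
  (forall y, U y -> differentiable f y) ->
  (forall y, U y -> differentiable ('D_u f) y) ->
  exists s t : R, [/\ 0 < s < h, 0 < t < h &
   f (x + h *: u + h *: v) - f (x + h *: u) - f (x + h *: v) + f x =
    h ^+ 2 * 'D_v ('D_u f) (x + s *: u + t *: v)].
Proof.
move=> h0 hU df ddf.
pose g y := f (y + h *: v) - f y.
have dsh y : U (y + h *: v) -> derivable (fun y => f (y + h *: v)) y u /\
   'D_u (fun y => f (y + h *: v)) y = 'D_u f (y + h *: v).
  move=> Uy; have /diff_derivable -/(_ u) := df _ Uy.
  have E : (fun k : R => k^-1 *: (((fun y => f (y + h *: v)) \o shift y) (k *: u) -
        f (y + h *: v)))
   = (fun k : R => k^-1 *: ((f \o shift (y + h *: v)) (k *: u) - f (y + h *: v))).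
    by apply/funext => k /=; rewrite addrA.
  by rewrite /derivable /derive E.
have h00 : 0 <= (0:R) <= h by rewrite lexx ltW.
have hh : 0 <= h <= h by rewrite lexx ltW.
have [|s sh Es] := @mvt_line g x u h h0.
  move=> s b; apply: derivableB; first by have [] := dsh _ (hU _ _ b hh).
  by apply: diff_derivable; apply: df; rewrite -[_ + _]addr0 -(scale0r v); exact: hU.
have sh' : 0 <= s <= h by case/andP: sh => ? ?; rewrite !ltW.
have [|t th Et] := @mvt_line ('D_u f) (x + s *: u) v h h0.
  by move=> t th; apply: diff_derivable; apply: ddf; exact: hU.
exists s, t; split=> //.
rewrite expr2 -mulrA -Et.
have [D1 D2] := dsh _ (hU _ _ sh' hh).
rewrite /g deriveB // ?D2 in Es.
  by rewrite -Es opprB !addrA addrAC.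
by apply: diff_derivable; apply: df; rewrite -[_ + _]addr0 -(scale0r v); exact: hU.
Qed.

Lemma nbhs_parallelogram (U : set V) x u v : nbhs x U ->
  exists2 h : R, 0 < h &
   forall s t : R, 0 <= s <= h -> 0 <= t <= h -> U (x + s *: u + t *: v).
Proof.
case/nbhs_ballP => e /= e0 bU.
have n0 : 0 < `|u| + `|v| + 1 by rewrite ltr_wpDl.
exists (e / 2 / (`|u| + `|v| + 1)); first by rewrite !divr_gt0.
move=> s t /andP[s0 sh] /andP[t0 th]; apply: bU.
rewrite -ball_normE /= -addrA opprD addNKr normrN.
apply: (@le_lt_trans _ _ (s * `|u| + t * `|v|)).
  by rewrite (le_trans (ler_normD _ _)) // !normrZ !ger0_norm.
apply: (@le_lt_trans _ _ (e / 2)); last by lra.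
have := divfK (lt0r_neq0 n0) (e / 2).
set h := e / 2 / _ in sh th *.
have := normr_ge0 u; have := normr_ge0 v; nra.
Qed.

Let same_limit (a b c d h x1 x2 x3 x4 : R) : h != 0 ->
  x1 - x2 - x3 + x4 = h ^+ 2 * c -> x1 - x3 - x2 + x4 = h ^+ 2 * d ->
  `|a - c| < `|a - b| / 2 -> `|b - d| < `|a - b| / 2 -> False.
Proof.
move=> h0 E1 E2; have -> : d = c.
  by apply: (mulfI (expf_neq0 2 h0)); rewrite -E1 -E2 [X in X + _ = _]addrAC.
rewrite [`|b - c|]distrC => A B; suff : `|a - b| < `|a - b| by rewrite ltxx.
rewrite [ltRHS]splitr; apply: le_lt_trans (ltrD A B); exact: ler_distD.
Qed.

(** At a point of continuity both mixed second derivatives are limits of the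
    same symmetric second difference. *)
Lemma schwarz (U : set V) f x u v : open U -> U x ->
  (forall y, U y -> differentiable f y) ->
  (forall y, U y -> differentiable ('D_u f) y) ->
  (forall y, U y -> differentiable ('D_v f) y) ->
  {for x, continuous ('D_v ('D_u f))} -> {for x, continuous ('D_u ('D_v f))} ->
  'D_v ('D_u f) x = 'D_u ('D_v f) x.
Proof.
move=> oU Ux df du dv cu cv.
apply/eqP; rewrite -subr_eq0 -normr_le0 leNgt; apply/negP => e0.
set e := `|_| in e0.
have e2 : 0 < e / 2 by lra.
have /cvgrPdist_lt/(_ _ e2) n1 := cu.
have /cvgrPdist_lt/(_ _ e2) n2 := cv.
have [h h0 P1] := nbhs_parallelogram u v (filterI (open_nbhs_nbhs (conj oU Ux)) (filterI n1 n2)).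
have [s [t [sh th E1]]] := mixed_difference h0 (fun s t a b => (P1 s t a b).1) df du.
have P2 : forall s t : R, 0 <= s <= h -> 0 <= t <= h -> U (x + s *: v + t *: u).
  by move=> ? ? ? ?; rewrite addrAC; apply: (P1 _ _ _ _).1.
have [t' [s' [th' sh' E2]]] := mixed_difference h0 P2 df dv.
have W (a : R) : 0 < a < h -> 0 <= a <= h by case/andP=> ? ?; rewrite !ltW.
move: (P1 _ _ (W _ sh) (W _ th)).2.1 (P1 _ _ (W _ sh') (W _ th')).2.2 => /=.
have C1 : x + s' *: u + t' *: v = x + t' *: v + s' *: u by rewrite addrAC.
have C2 : x + h *: v + h *: u = x + h *: u + h *: v by rewrite addrAC.
rewrite C1; rewrite C2 in E2.
exact: same_limit (lt0r_neq0 h0) E1 E2.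
Qed.

Lemma taylor1_line f x v (h B : R) : 0 < h ->
  (forall s : R, 0 <= s <= h -> derivable f (x + s *: v) v) ->
  (forall s : R, 0 <= s <= h -> derivable ('D_v f) (x + s *: v) v) ->
  (forall s : R, 0 <= s <= h -> `|'D_v ('D_v f) (x + s *: v)| <= B) ->
  `|f (x + h *: v) - f x - h * 'D_v f x| <= B * h ^+ 2.
Proof.
move=> h0 d1 d2 b.
have [s /andP[s0 sh] ->] := mvt_line h0 d1.
have [|t /andP[t0 ts] E] := @mvt_line ('D_v f) x v s s0.
  by move=> r /andP[r0 rs]; apply: d2; rewrite r0 (le_trans rs) // ltW.
have Bb : `|'D_v ('D_v f) (x + t *: v)| <= B.
  by apply: b; rewrite ltW //= ltW // (lt_trans ts).
rewrite -mulrBr E !normrM (gtr0_norm h0) (gtr0_norm s0).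
have hs : h * s <= h * h by rewrite ler_pM2l // ltW.
by rewrite mulrA [leRHS]mulrC expr2 ler_pM // mulr_ge0 // ltW.
Qed.

End Lines.

(** * Closure properties of smooth functions *)

Section Local.
Context {R : realType} {V W : normedModType R}.

Lemma near_zero_differentiable (f : V -> W) (x : V) :
  (\near x, f x = 0) -> differentiable f x.
Proof.
move=> f0; apply/diffP.
apply: (@getPex _ (fun (df : {linear V -> W}) => continuous df /\
  forall y, f y = f (lim (nbhs x)) + df (y - lim (nbhs x))
                  +o_(y \near x) (y - lim (nbhs x)))).
exists (GRing.null_fun W : {linear V -> W}); split; first exact: cst_continuous.
suff E : f = cst (f (lim (nbhs x))) + (fun=> 0) +o_x (fun y => y - lim (nbhs x)).
  by apply: eqaddoEx => y; exact: (congr1 (fun g : V -> W => g y) E).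
apply/eqaddoP => _/posnumP[e].
near=> y; rewrite /= !fctE lim_id // (nbhs_singleton f0) (near f0 y) // addr0 subrr normr0.
by rewrite mulr_ge0.
Unshelve. all: by end_near. Qed.

(** The differential is selected by a choice operator, so locality is obtained by
    adding a function that vanishes near the point. *)
Lemma near_eq_differentiable (f g : V -> W) (x : V) :
  (\near x, f x = g x) -> differentiable f x -> differentiable g x.
Proof.
move=> fg df; have -> : g = f + (g - f) by apply/funext => y; rewrite !fctE addrC subrK.
apply: differentiableD => //; apply: near_zero_differentiable.
by near=> y; rewrite !fctE (near fg y) // subrr.
Unshelve. all: by end_near. Qed.

End Local.

Section MatrixValued.
Context {R : realType} {V : normedModType R} {m n : nat}.
Implicit Types F : V -> 'M[R]_(m, n).

Lemma differentiable_mxP F x :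
  differentiable F x <-> forall i j, differentiable (fun y => F y i j) x.
Proof.
split=> [dF i j|dF].
  apply: (@differentiable_comp _ _ _ _ F (fun M : 'M[R]_(m, n) => M i j)) => //.
  exact: differentiable_coord.
have -> : F = \sum_(i < m) (\sum_(j < n) (fun y => F y i j *: delta_mx i j)).
  apply/funext => y; rewrite {1}(matrix_sum_delta (F y)) fct_sumE.
  by apply: eq_bigr => i _; rewrite fct_sumE.
apply: differentiable_sum => i; apply: differentiable_sum => j.
exact: differentiableZl.
Qed.

Lemma derive_mxE F x v i j : differentiable F x ->
  ('D_v F x) i j = 'D_v (fun y => F y i j) x.
Proof. by move=> dF; rewrite derive_mx ?mxE //; exact: diff_derivable. Qed.

End MatrixValued.

Section Basis.
Context {R : realType} {n : nat} {W : normedModType R}.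

Lemma derive_basis (f : 'rV[R]_n -> W) x v : differentiable f x ->
  'D_v f x = \sum_i v 0 i *: 'D_(delta_mx 0 i) f x.
Proof.
move=> df; rewrite deriveE // {1}(row_sum_delta v) linear_sum.
by apply: eq_bigr => i _; rewrite linearZ /= deriveE.
Qed.

End Basis.

Lemma derive_chain {R : realType} {V W : normedModType R} {n : nat}
    (f : 'rV[R]_n -> W) (phi : V -> 'rV[R]_n) x v :
  differentiable phi x -> differentiable f (phi x) ->
  'D_v (f \o phi) x = 'D_('D_v phi x) f (phi x).
Proof.
move=> dphi df; rewrite !deriveE //; last exact: differentiable_comp.
by rewrite diff_comp // deriveE.
Qed.

Section SmoothOn.
Context {R : realType} {V W : normedModType R}.
Implicit Types (U : set V) (F : V -> W).

Lemma smooth_on_differentiable U F x : smooth_on U F -> U x -> differentiable F x.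
Proof. by move=> sF; apply: (sF [::]). Qed.

Lemma smooth_on_derive U F v : smooth_on U F -> smooth_on U ('D_v F).
Proof.
move=> sF s x Ux; have := sF (rcons s v) x Ux.
by rewrite /iter_derive foldr_rcons.
Qed.

Lemma smooth_onS U U' F : U' `<=` U -> smooth_on U F -> smooth_on U' F.
Proof. by move=> UU sF s x /UU; exact: sF. Qed.

Lemma open_near_eq U (P : V -> Prop) x :
  open U -> U x -> (forall y, U y -> P y) -> \near x, P x.
Proof.
by move=> oU Ux UP; apply: filterS UP _; exact: open_nbhs_nbhs.
Qed.

(** Smoothness by coinduction: an induction on the list of directions keeps the
    iterated derivative in the family.  All closure properties rest on it. *)
Lemma smooth_on_coind U (P : (V -> W) -> Prop) : open U ->
  (forall F, P F -> forall x, U x -> differentiable F x) ->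
  (forall F, P F -> forall v, exists2 G, P G & forall x, U x -> 'D_v F x = G x) ->
  forall F, P F -> smooth_on U F.
Proof.
move=> oU Pd PD F PF s.
suff [G PG FG] : exists2 G, P G & forall x, U x -> iter_derive s F x = G x.
  move=> x Ux; apply: (@near_eq_differentiable _ _ _ G); last exact: Pd PG _ Ux.
  by apply: (open_near_eq oU) => // y /FG ->.
elim: s => [|v s [G PG FG]] /=; first by exists F.
have [H PH GH] := PD _ PG v; exists H => // x Ux.
rewrite -GH //; apply: near_eq_derive.
by apply: (open_near_eq oU) => // y /FG ->.
Qed.

Lemma smooth_on_eq U F G : open U -> smooth_on U F ->
  (forall x, U x -> F x = G x) -> smooth_on U G.
Proof.
move=> oU sF FG.
pose P (h : V -> W) := exists2 k, smooth_on U k & forall x, U x -> h x = k x.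
apply: (@smooth_on_coind U P) => //; last by exists F => // x /FG ->.
  move=> h [k sk hk] x Ux; apply: (@near_eq_differentiable _ _ _ k).
    by apply: (open_near_eq oU) => // y /hk ->.
  exact: smooth_on_differentiable sk Ux.
move=> h [k sk hk] v; exists ('D_v k).
  by exists ('D_v k) => //; exact: smooth_on_derive.
move=> x Ux; apply: near_eq_derive.
by apply: (open_near_eq oU) => // y /hk ->.
Qed.

End SmoothOn.

Section Algebra.
Context {R : realType} {V : normedModType R}.

(** Closing the smooth functions under composition, sums, products and inverses
    gives a family that is stable under derivation, whereas iterated derivatives
    of a product or of a composite have no manageable closed formula. *)
Inductive smooth_alg (U : set V) : (V -> R) -> Prop :=
| SAgen f of smooth_on U f : smooth_alg U f
| SAcomp n (U' : set 'rV[R]_n) (f : 'rV[R]_n -> R) (phi : V -> 'rV[R]_n) of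
    smooth_on U' f & (forall x, U x -> U' (phi x)) &
    (forall i, smooth_alg U (fun x => phi x 0 i)) : smooth_alg U (f \o phi)
| SAadd f g of smooth_alg U f & smooth_alg U g : smooth_alg U (f + g)
| SAmul f g of smooth_alg U f & smooth_alg U g : smooth_alg U (f * g)
| SAinv f of smooth_alg U f & (forall x, U x -> f x != 0) :
    smooth_alg U (fun x => (f x)^-1).

Lemma smooth_on_cst (U : set V) (c : R) : smooth_on U (cst c).
Proof.
move=> s x _; suff [d ->] : exists d, iter_derive s (cst c : V -> R) = cst d.
  exact: differentiable_cst.
elim: s => [|v s [d IH]] /=; first by exists c.
by exists 0; rewrite IH; apply/funext => y; rewrite derive_cst.
Qed.

Lemma smooth_alg_derive (U : set V) f : smooth_alg U f ->
  (forall x, U x -> differentiable f x) /\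
  forall v, exists2 g, smooth_alg U g & forall x, U x -> 'D_v f x = g x.
Proof.
elim=> {f} [f sf|n U' f phi sf hU sphi IH|f g sf [df Df] sg [dg Dg]|
  f g sf [df Df] sg [dg Dg]|f sf [df Df] f0].
- split; first by move=> x; exact: smooth_on_differentiable.
  by move=> v; exists ('D_v f) => //; apply: SAgen; exact: smooth_on_derive.
- have dphi x : U x -> differentiable phi x.
    by move=> Ux; apply/differentiable_mxP => i j; rewrite ord1; apply: (IH j).1.
  have df x : U x -> differentiable f (phi x).
    by move=> Ux; apply: smooth_on_differentiable sf _; exact: hU.
  split; first by move=> x Ux; apply: differentiable_comp; [exact: dphi|exact: df].
  move=> v.
  have /choice [g Hg] : forall i, exists g, smooth_alg U g /\
     forall x, U x -> 'D_v (fun x => phi x 0 i) x = g x.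
    by move=> i; have [g ? ?] := (IH i).2 v; exists g.
  pose h i := ('D_(delta_mx 0 i) f \o phi : V -> R).
  exists (\sum_i g i * h i).
    elim/big_ind: _ => [|? ?|i _]; [exact/SAgen/smooth_on_cst|exact: SAadd|].
    apply: SAmul; first exact: (Hg i).1.
    by apply: SAcomp hU _; [exact: smooth_on_derive|exact: sphi].
  move=> x Ux; apply: (etrans (derive_chain v (dphi _ Ux) (df _ Ux))).
  apply: (etrans (derive_basis _ (df _ Ux))); rewrite fct_sumE.
  by apply: eq_bigr => i _; rewrite (derive_mxE _ _ _ (dphi _ Ux)) (Hg i).2.
- split; first by move=> x Ux; apply: differentiableD; [exact: df|exact: dg].
  move=> v; have [f' sf' Ef] := Df v; have [g' sg' Eg] := Dg v.
  exists (f' + g'); first exact: SAadd.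
  by move=> x Ux; rewrite deriveD ?Ef ?Eg//; apply: diff_derivable; [exact: df|exact: dg].
- split; first by move=> x Ux; apply: differentiableM; [exact: df|exact: dg].
  move=> v; have [f' sf' Ef] := Df v; have [g' sg' Eg] := Dg v.
  exists (f * g' + g * f'); first by apply: SAadd; exact: SAmul.
  by move=> x Ux; rewrite deriveM ?Ef ?Eg//; apply: diff_derivable; [exact: df|exact: dg].
- split; first by move=> x Ux; apply: differentiableV; [exact: df|exact: f0].
  move=> v; have [f' sf' Ef] := Df v.
  exists (cst (-1) * ((fun x => (f x)^-1) * (fun x => (f x)^-1)) * f').
    apply: SAmul => //; apply: SAmul; first exact/SAgen/smooth_on_cst.
    by apply: SAmul; exact: SAinv.
  move=> x Ux; rewrite deriveV ?f0 ?Ef //; last by apply: diff_derivable; exact: df.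
  by rewrite !fctE -exprVn /GRing.scale /=; ring.
Qed.

Lemma smooth_algP (U : set V) f : open U -> smooth_alg U f -> smooth_on U f.
Proof.
by move=> oU; apply: smooth_on_coind => // {}f /smooth_alg_derive[].
Qed.

End Algebra.

Section SmoothOps.
Context {R : realType} {V : normedModType R} (U : set V) (oU : open U).
Implicit Types f g : V -> R.

Lemma smooth_on_sum (I : Type) (r : seq I) (P : pred I) (f : I -> V -> R) :
  (forall i, P i -> smooth_on U (f i)) ->
  smooth_on U (fun x => \sum_(i <- r | P i) f i x).
Proof.
move=> sf; rewrite -fct_sumE; apply: smooth_algP => //.
elim/big_ind: _ => [|? ?|i Pi]; [exact/SAgen/smooth_on_cst|exact: SAadd|].
exact/SAgen/sf.
Qed.

Lemma smooth_on_prod (I : Type) (r : seq I) (P : pred I) (f : I -> V -> R) :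
  (forall i, P i -> smooth_on U (f i)) ->
  smooth_on U (fun x => \prod_(i <- r | P i) f i x).
Proof.
move=> sf; rewrite -fct_prodE; apply: smooth_algP => //.
elim/big_ind: _ => [|? ?|i Pi]; [exact/SAgen/smooth_on_cst|exact: SAmul|].
exact/SAgen/sf.
Qed.

Lemma smooth_onM f g : smooth_on U f -> smooth_on U g ->
  smooth_on U (fun x => f x * g x).
Proof. by move=> sf sg; apply: smooth_algP => //; apply: SAmul; exact: SAgen. Qed.

Lemma smooth_onD f g : smooth_on U f -> smooth_on U g ->
  smooth_on U (fun x => f x + g x).
Proof. by move=> sf sg; apply: smooth_algP => //; apply: SAadd; exact: SAgen. Qed.

Lemma smooth_onN f : smooth_on U f -> smooth_on U (fun x => - f x).
Proof.
move=> sf; have -> : (fun x => - f x) = fun x => -1 * f x.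
  by apply/funext => x; rewrite mulN1r.
by apply: smooth_onM => //; exact: smooth_on_cst.
Qed.

Lemma smooth_onV f : smooth_on U f -> (forall x, U x -> f x != 0) ->
  smooth_on U (fun x => (f x)^-1).
Proof. by move=> sf f0; apply: smooth_algP => //; apply: SAinv => //; exact: SAgen. Qed.

Lemma smooth_on_comp n (U' : set 'rV[R]_n) (f : 'rV[R]_n -> R) (phi : V -> 'rV[R]_n) :
  smooth_on U' f -> (forall x, U x -> U' (phi x)) ->
  (forall i, smooth_on U (fun x => phi x 0 i)) ->
  smooth_on U (fun x => f (phi x)).
Proof.
move=> sf hU sphi; apply: smooth_algP => //; apply: SAcomp sf hU _ => i.
exact/SAgen/sphi.
Qed.

Lemma smooth_on_mxP m n (F : V -> 'M[R]_(m, n)) :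
  smooth_on U F <-> forall i j, smooth_on U (fun x => F x i j).
Proof.
split=> [sF i j|].
  pose P (h : V -> R) := exists2 G, smooth_on U G & h = fun x => (G x : 'M[R]_(m, n)) i j.
  apply: (@smooth_on_coind _ _ _ U P) => //; last by exists F.
    move=> _ [G sG ->] x Ux.
    by move: (smooth_on_differentiable sG Ux) => /differentiable_mxP; exact.
  move=> _ [G sG ->] v; exists (fun x => 'D_v G x i j).
    by exists ('D_v G) => //; exact: smooth_on_derive.
  by move=> x Ux; rewrite derive_mxE //; exact: smooth_on_differentiable sG Ux.
move=> sF; pose P (G : V -> 'M[R]_(m, n)) := forall i j, smooth_on U (fun x => G x i j).
apply: (@smooth_on_coind _ _ _ U P) => // {sF}G sG.
  by move=> x Ux; apply/differentiable_mxP => i j; exact: smooth_on_differentiable (sG i j) Ux.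
move=> v; exists (fun x => \matrix_(i, j) 'D_v (fun y => G y i j) x).
  move=> i j; rewrite (_ : (fun _ => _) = 'D_v (fun y => G y i j)).
    exact: smooth_on_derive.
  by apply/funext => x; rewrite mxE.
move=> x Ux; rewrite derive_mx //; apply: diff_derivable.
by apply/differentiable_mxP => i j; exact: smooth_on_differentiable (sG i j) Ux.
Qed.

Lemma smooth_on_mulmx m n p (F : V -> 'M[R]_(m, n)) (G : V -> 'M[R]_(n, p)) :
  smooth_on U F -> smooth_on U G -> smooth_on U (fun x => F x *m G x).
Proof.
move=> /smooth_on_mxP sF /smooth_on_mxP sG; apply/smooth_on_mxP => i j.
rewrite (_ : (fun _ => _) = fun x => \sum_k F x i k * G x k j).
  by apply: smooth_on_sum => k _; apply: smooth_onM.
by apply/funext => x; rewrite mxE.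
Qed.

Lemma smooth_on_trmx m n (F : V -> 'M[R]_(m, n)) :
  smooth_on U F -> smooth_on U (fun x => (F x)^T).
Proof.
move=> /smooth_on_mxP sF; apply/smooth_on_mxP => i j.
by rewrite (_ : (fun _ => _) = fun x => F x j i) //; apply/funext => x; rewrite mxE.
Qed.

Lemma smooth_on_det n (F : V -> 'M[R]_n) :
  smooth_on U F -> smooth_on U (fun x => \det (F x)).
Proof.
move=> /smooth_on_mxP sF; apply: smooth_on_sum => s _.
by apply: smooth_onM; [exact: smooth_on_cst|apply: smooth_on_prod => i _].
Qed.

Lemma smooth_on_invmx n (F : V -> 'M[R]_n) : smooth_on U F ->
  (forall x, U x -> F x \in unitmx) -> smooth_on U (fun x => invmx (F x)).
Proof.
move=> sF uF; have /smooth_on_mxP sF' := sF; apply/smooth_on_mxP => i j.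
apply: (@smooth_on_eq _ _ _ _ (fun x => (\det (F x))^-1 * cofactor (F x) j i)) => //; last first.
  by move=> x Ux; rewrite /invmx uF // !mxE.
apply: smooth_onM.
  by apply: smooth_onV => [|x /uF]; [exact: smooth_on_det|rewrite unitmxE unitfE].
apply: smooth_onM; first exact: smooth_on_cst.
apply: smooth_on_det; apply/smooth_on_mxP => k l.
rewrite (_ : (fun _ => _) = fun x => F x (lift j k) (lift i l)) //.
by apply/funext => x; rewrite !mxE.
Qed.

End SmoothOps.

Section LinearComp.
Context {R : realType} {V V' W : normedModType R}.

(** Directional derivatives only see lines, so precomposition with an affine
    map needs no differentiability. *)
Lemma derive_affine (f : V' -> W) (L : V -> V') (l : V -> V') x v :
  (forall (h : R) y, L (h *: v + y) = h *: l v + L y) ->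
  'D_v (f \o L) x = 'D_(l v) f (L x).
Proof.
move=> HL; have E : (fun h : R => h^-1 *: (((f \o L) \o shift x) (h *: v) - (f \o L) x))
  = (fun h : R => h^-1 *: ((f \o shift (L x)) (h *: l v) - f (L x))).
  by apply/funext => h /=; rewrite HL.
by rewrite /derive E.
Qed.

End LinearComp.

(** * A divergence theorem for grid sums *)

Section Box.
Context {R : realType} {n : nat}.

Definition box (a L : 'I_n -> R) : set 'rV[R]_n :=
  [set x | forall i, a i <= x 0 i <= a i + L i].

Lemma compact_box a L : compact (box a L).
Proof.
rewrite (_ : box a L = [set v : 'rV[R]_n | forall i, [set` `[a i, a i + L i]] (v ord0 i)]).
  by apply: (@rV_compact R n (fun i => [set` `[a i, a i + L i]])) => i; exact: segment_compact.
by apply/seteqP; split=> x bx i; have := bx i; rewrite /= in_itv.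
Qed.

Lemma compact_bounded_above (A : set 'rV[R]_n) (f : 'rV[R]_n -> R) : compact A ->
  (forall x, A x -> {for x, continuous f}) -> exists2 B, 0 <= B & forall x, A x -> `|f x| <= B.
Proof.
move=> cA cf; have [[x0 Ax0]|A0] := pselect (A !=set0); last first.
  by exists 0 => // x Ax; case: A0; exists x.
have cf' : {within A, continuous (fun x => `|f x|)}.
  apply: continuous_in_subspaceT => x; rewrite inE => Ax.
  by apply: continuous_comp (cf x Ax) _; exact: norm_continuous.
have [|c _ H] := @EVT_max_rV _ _ _ A _ cA cf'; first by exists x0.
by exists `|f c| => // x Ax; apply: H; rewrite inE.
Qed.

End Box.

Section Grid.
Context {R : realType} {n : nat} (N : nat).
Implicit Types (f : {ffun 'I_n -> 'I_N}) (k : 'I_n).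

(** Points of the grid are indexed by nat-valued functions, because the upper
    faces correspond to the value [N], outside ['I_N]. *)
Definition upd (f : 'I_n -> nat) k (j : nat) : 'I_n -> nat :=
  fun i => if i == k then j else f i.

(** The map (f, j) |-> (f with j at k, f k) is an involution, so each grid
    function is hit [N] times. *)
Lemma sum_upd k (H : ('I_n -> nat) -> R) :
  \sum_(f : {ffun 'I_n -> 'I_N}) \sum_(j < N) H (upd (fun i => f i) k j)
  = N%:R * \sum_(f : {ffun 'I_n -> 'I_N}) H (fun i => f i).
Proof.
pose sw (p : {ffun 'I_n -> 'I_N} * 'I_N) : {ffun 'I_n -> 'I_N} * 'I_N :=
  ([ffun i => if i == k then p.2 else p.1 i], p.1 k).
have swK : involutive sw.
  move=> [f j]; rewrite /sw /= ffunE eqxx; congr (_, _).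
  by apply/ffunP => i; rewrite !ffunE /=; case: eqP => // ->.
rewrite pair_big /= (reindex_inj (inv_inj swK)) /=.
transitivity (\sum_(p : {ffun 'I_n -> 'I_N} * 'I_N) H (fun i => p.1 i)).
  apply: eq_bigr => -[f j] _; congr H; apply/funext => i /=.
  by rewrite /upd ffunE; case: eqP => // ->.
rewrite -(pair_big xpredT xpredT (fun f _ => H (fun i => f i))) /= mulr_sumr.
by apply: eq_bigr => f _; rewrite sumr_const card_ord mulr_natl.
Qed.

Lemma sum_telescope k (G : ('I_n -> nat) -> R) :
  N%:R * \sum_(f : {ffun 'I_n -> 'I_N})
     (G (upd (fun i => f i) k (f k).+1) - G (fun i => f i))
  = \sum_(f : {ffun 'I_n -> 'I_N})
     (G (upd (fun i => f i) k N) - G (upd (fun i => f i) k 0)).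
Proof.
rewrite -(sum_upd k (fun f : 'I_n -> nat => G (upd f k (f k).+1) - G f)).
apply: eq_bigr => f _.
rewrite -(telescope_sumr (fun j => G (upd (fun i => f i) k j)) (leq0n N)) big_mkord.
apply: eq_bigr => j _; congr (G _ - _); apply/funext => i.
by rewrite /upd eqxx; case: eqP.
Qed.

End Grid.

Section Divergence.
Context {R : realType} {n : nat} (a L : 'I_n -> R) (L0 : forall i, 0 < L i).

Definition grid_point (N : nat) (f : 'I_n -> nat) : 'rV[R]_n :=
  \row_i (a i + L i * ((f i)%:R / N%:R)).

(** Each difference quotient differs from the partial derivative by O(1/N), and
    the partial derivatives add up to 0; telescoping in every direction leaves
    the boundary faces only. *)
Lemma discrete_divergence (Z : 'I_n -> 'rV[R]_n -> R) :
  (forall k, smooth_on setT (Z k)) ->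
  (forall x, \sum_k 'D_(delta_mx 0 k) (Z k) x = 0) ->
  exists2 C, 0 <= C & forall N, (0 < N)%N ->
  `| \sum_k (L k)^-1 * \sum_(f : {ffun 'I_n -> 'I_N})
      (Z k (grid_point N (upd (fun i => f i) k N))
       - Z k (grid_point N (upd (fun i => f i) k 0))) |
  <= C / N%:R * (N ^ n)%:R.
Proof.
move=> sZ divZ.
have /choice [B HB] : forall k, exists B, 0 <= B /\ forall x, box a L x ->
    `|'D_(delta_mx 0 k) ('D_(delta_mx 0 k) (Z k)) x| <= B.
  move=> k; have [|B ? ?] := @compact_bounded_above _ _ (box a L)
    ('D_(delta_mx 0 k) ('D_(delta_mx 0 k) (Z k))) (@compact_box _ _ a L) _; last by exists B.
  move=> x _; apply: differentiable_continuous.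
  by apply: (@smooth_on_differentiable _ _ _ setT) => //; do 2 apply: smooth_on_derive.
exists (\sum_k B k * L k).
  by apply: sumr_ge0 => k _; rewrite mulr_ge0 ?(HB k).1 // ltW.
move=> N N0; have N0' : 0 < N%:R :> R by rewrite ltr0n.
have step k (f : {ffun 'I_n -> 'I_N}) :
    `|(N%:R / L k) * (Z k (grid_point N (upd (fun i => f i) k (f k).+1))
       - Z k (grid_point N (fun i => f i)))
      - 'D_(delta_mx 0 k) (Z k) (grid_point N (fun i => f i))| <= B k * L k / N%:R.
  set x := grid_point N (fun i => f i).
  have h0 : 0 < L k / N%:R by rewrite divr_gt0.
  have -> : grid_point N (upd (fun i => f i) k (f k).+1) = x + (L k / N%:R) *: delta_mx 0 k.
    apply/rowP => i; rewrite !mxE /upd eqxx /=; case: eqP => [->|_]; last by rewrite mulr0 addr0.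
    by rewrite mulr1 -natr1; field; rewrite gt_eqF.
  have inbox s : 0 <= s <= L k / N%:R -> box a L (x + s *: delta_mx 0 k).
    move=> /andP[s0 sh] i; rewrite !mxE eqxx /=.
    have f1 : (f i).+1%:R <= N%:R :> R by rewrite ler_nat ltn_ord.
    have fL : L i * ((f i)%:R / N%:R) + L i / N%:R <= L i.
      rewrite (_ : _ + _ = L i * ((f i).+1%:R / N%:R)); last by rewrite -natr1; ring.
      by apply: ler_piMr; [exact/ltW|rewrite ler_pdivrMr // mul1r].
    have f0 : 0 <= L i * ((f i)%:R / N%:R) by rewrite mulr_ge0 ?divr_ge0 // ltW.
    have h1 : 0 < L i / N%:R by rewrite divr_gt0.
    case: eqP => [ik|_]; [rewrite mulr1|rewrite mulr0].
      by rewrite -ik in sh; rewrite -addrA lerDl lerD2l; apply/andP; split; lra.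
    by rewrite addr0 lerDl lerD2l; apply/andP; split; lra.
  have dZ y : differentiable (Z k) y by exact: smooth_on_differentiable (sZ k) _.
  have ddZ y : differentiable ('D_(delta_mx 0 k) (Z k)) y.
    by apply: (@smooth_on_differentiable _ _ _ setT) => //; exact: smooth_on_derive.
  have := @taylor1_line _ _ (Z k) x (delta_mx 0 k) (L k / N%:R) (B k) h0
    (fun s _ => diff_derivable (dZ _)) (fun s _ => diff_derivable (ddZ _))
    (fun s hs => (HB k).2 _ (inbox s hs)).
  have hi : 0 < N%:R / L k by rewrite divr_gt0.
  have hE : (N%:R / L k) * (L k / N%:R) = 1 by field; rewrite !gt_eqF.
  rewrite -(ler_pM2l hi) -{1}(gtr0_norm hi) -normrM mulrBr [_ * (_ / _ * _)]mulrA hE mul1r.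
  have -> : N%:R / L k * (B k * (L k / N%:R) ^+ 2) = B k * L k / N%:R.
    by field; rewrite !gt_eqF.
  by [].
rewrite (eq_bigr (fun k => \sum_(f : {ffun 'I_n -> 'I_N})
  (N%:R / L k) * (Z k (grid_point N (upd (fun i => f i) k (f k).+1))
       - Z k (grid_point N (fun i => f i))))); last first.
  move=> k _; rewrite -(sum_telescope N k (fun f : 'I_n -> nat => Z k (grid_point N f))).
  by rewrite mulrA [_^-1 * _]mulrC mulr_sumr.
rewrite exchange_big /=.
rewrite (eq_bigr (fun f : {ffun 'I_n -> 'I_N} => \sum_k
  ((N%:R / L k) * (Z k (grid_point N (upd (fun i => f i) k (f k).+1))
       - Z k (grid_point N (fun i => f i)))
     - 'D_(delta_mx 0 k) (Z k) (grid_point N (fun i => f i))))); last first.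
  by move=> f _; rewrite big_split /= sumrN divZ subr0.
apply: le_trans (ler_norm_sum _ _ _) _.
apply: (@le_trans _ _ (\sum_(f : {ffun 'I_n -> 'I_N}) \sum_k B k * L k / N%:R)).
  apply: ler_sum => f _; apply: le_trans (ler_norm_sum _ _ _) _.
  by apply: ler_sum => k _; exact: step.
by rewrite sumr_const card_ffun !card_ord -mulr_suml mulr_natr.
Qed.

End Divergence.

(** * Pfaffians of alternating 6 x 6 matrices *)

Section Pfaffian.
Context {R : realFieldType}.
Implicit Types w v : nat -> nat -> R.

Definition alternating_form w := forall a b, w a b = - w b a.

(** Polarization of the 4 x 4 Pfaffian; [pf4 w w] is twice the Pfaffian. *)
Definition pf4 w v (a b c d : nat) : R :=
  w a b * v c d - w a c * v b d + w a d * v b c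
  + (v a b * w c d - v a c * w b d + v a d * w b c).

(** The coefficient of the 4-form w /\ v on the complement of {k, j}, with the
    sign of that complement.  Indices are natural numbers, so that the complement
    computes. *)
Definition pf_cofactor w v (k j : nat) : R :=
  if k == j then 0 else
  let s := [seq i <- iota 0 6 | (i != k) && (i != j)] in
  let p := pf4 w v (nth 0 s 0) (nth 0 s 1) (nth 0 s 2) (nth 0 s 3) in
  if odd (k + j + (k < j)%N) then - p else p.

Ltac unroll6 := rewrite !big_ord_recl !big_ord0 /= /bump /= ?add1n /pf_cofactor /pf4 /=.

(** In coordinates: w /\ dw = 0 when dw = 0, where [v k] stands for the
    derivative of w in the direction k. *)
Lemma pf_cofactor_closed w (v : nat -> nat -> nat -> R) j : (j < 6)%N ->
  (forall k, alternating_form (v k)) ->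
  (forall a b c, v a b c + v b c a + v c a b = 0) ->
  \sum_(k < 6) pf_cofactor w (v k) k j = 0.
Proof.
move=> j6 vA vC.
have C a b c : v c a b = v b a c - v a b c.
  by have := vC a b c; rewrite (vA b c a) => /eqP; rewrite addr_eq0 => /eqP; lra.
case: j j6 => [|[|[|[|[|[|//]]]]]] _; unroll6;
rewrite ?(C 0 1 2)%N ?(C 0 1 3)%N ?(C 0 1 4)%N ?(C 0 1 5)%N ?(C 0 2 3)%N
  ?(C 0 2 4)%N ?(C 0 2 5)%N ?(C 0 3 4)%N ?(C 0 3 5)%N ?(C 0 4 5)%N
  ?(C 1 2 3)%N ?(C 1 2 4)%N ?(C 1 2 5)%N ?(C 1 3 4)%N ?(C 1 3 5)%N
  ?(C 1 4 5)%N ?(C 2 3 4)%N ?(C 2 3 5)%N ?(C 2 4 5)%N ?(C 3 4 5)%N; rewrite ?(mul0r, mulr0, add0r, addr0); ring.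
Qed.

Lemma pf_cofactorC w v k j : pf_cofactor w v k j = - pf_cofactor w v j k.
Proof.
wlog kj : k j / (k < j)%N.
  by move=> W; case: (ltngtP k j) => [/W//|/W->|->]; rewrite ?opprK // /pf_cofactor eqxx oppr0.
have E : [seq i <- iota 0 6 | (i != j) && (i != k)] = [seq i <- iota 0 6 | (i != k) && (i != j)].
  by apply: eq_filter => i; rewrite andbC.
rewrite /pf_cofactor E (ltn_eqF kj) (gtn_eqF kj) kj ltnNge (ltnW kj) /= addn1 addn0 (addnC j) /=.
by case: odd; rewrite /= ?opprK.
Qed.

(** Twelve times the usual Pfaffian: the expansions along the six rows are
    added up, and [pf4 w w] counts twice. *)
Definition pfaffian w : R := \sum_(k < 6) \sum_(j < 6) w k j * pf_cofactor w w k j.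

Lemma pf_cofactor_mul w i l : alternating_form w -> (i < 6)%N -> (l < 6)%N ->
  \sum_(j < 6) w i j * pf_cofactor w w l j = (i == l)%:R * \sum_(j < 6) w 0%N j * pf_cofactor w w 0 j.
Proof.
move=> A i6 l6.
have D a : w a a = 0 by have := A a a; lra.
case: i i6 => [|[|[|[|[|[|//]]]]]] _; case: l l6 => [|[|[|[|[|[|//]]]]]] _;
rewrite ?mul1r ?mul0r //; unroll6;
rewrite ?D ?(A 1 0)%N ?(A 2 0)%N ?(A 2 1)%N ?(A 3 0)%N ?(A 3 1)%N ?(A 3 2)%N ?(A 4 0)%N ?(A 4 1)%N
  ?(A 4 2)%N ?(A 4 3)%N ?(A 5 0)%N ?(A 5 1)%N ?(A 5 2)%N ?(A 5 3)%N ?(A 5 4)%N; rewrite ?(mul0r, mulr0, add0r, addr0); ring.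
Qed.

Lemma pfaffianE w : alternating_form w -> pfaffian w = 6 * \sum_(j < 6) w 0%N j * pf_cofactor w w 0 j.
Proof.
move=> A; rewrite /pfaffian (eq_bigr (fun=> \sum_(j < 6) w 0%N j * pf_cofactor w w 0 j)).
  by rewrite sumr_const card_ord mulr_natl.
by move=> k _; rewrite pf_cofactor_mul // eqxx mul1r.
Qed.

(** If the Pfaffian vanishes, the rows of the cofactor matrix lie in the kernel
    of w, so all 4 x 4 Pfaffians vanish too; these are the pairings of w with
    the vector w_bc e_0 - w_0c e_b + w_0b e_c, which is then in the kernel. *)
Lemma pfaffian_neq0 w : alternating_form w ->
  (forall u : nat -> R, (forall j, (j < 6)%N -> \sum_(i < 6) u i * w i j = 0) ->
     forall i, (i < 6)%N -> u i = 0) ->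
  pfaffian w != 0.
Proof.
move=> A nd; apply/eqP; rewrite pfaffianE // => /eqP; rewrite mulf_eq0 pnatr_eq0 /= => /eqP Q0.
have D a : w a a = 0 by have := A a a; lra.
have C0 l j : (l < 6)%N -> (j < 6)%N -> pf_cofactor w w l j = 0.
  move=> l6; apply: nd => i i6.
  rewrite (eq_bigr (fun j : 'I_6 => - (w i j * pf_cofactor w w l j))) => [|k _].
    by rewrite sumrN pf_cofactor_mul // Q0 mulr0 oppr0.
  by rewrite A mulrN mulrC.
have [b b6 wb] : exists2 b, (b < 6)%N & w 0%N b != 0.
  apply: contrapT => H.
  have /(_ 0%N isT) : forall i, (i < 6)%N -> (i == 0)%N%:R = 0 :> R.
    apply: nd => j j6; rewrite !big_ord_recl !big_ord0 /= !mul0r !addr0 mul1r.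
    by apply: contrapT => /eqP ?; apply: H; exists j.
  by move/eqP; rewrite oner_eq0.
(* Any index other than 0 and b. *)
pose c := if b == 1%N then 2%N else 1%N.
pose u i : R := if i == 0%N then w b c else if i == b then - w 0%N c
   else if i == c then w 0%N b else 0.
have uc : u c = w 0%N b.
  by rewrite /u /c; case: b b6 {wb c u} => [|[|[|[|[|[|//]]]]]] //= _; rewrite ?D ?oppr0.
have c6 : (c < 6)%N by rewrite /c; case: eqP.
suff u0 : forall i, (i < 6)%N -> u i = 0 by rewrite -uc u0 // eqxx in wb.
apply: nd => j j6.
have := (C0 0 1 isT isT)%N; have := (C0 0 2 isT isT)%N; have := (C0 0 3 isT isT)%N.
have := (C0 0 4 isT isT)%N; have := (C0 0 5 isT isT)%N; have := (C0 1 2 isT isT)%N.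
have := (C0 1 3 isT isT)%N; have := (C0 1 4 isT isT)%N; have := (C0 1 5 isT isT)%N.
have := (C0 2 3 isT isT)%N; have := (C0 2 4 isT isT)%N; have := (C0 2 5 isT isT)%N.
have := (C0 3 4 isT isT)%N; have := (C0 3 5 isT isT)%N; have := (C0 4 5 isT isT)%N.
rewrite /u /c => {uc c6 u c}.
case: b b6 wb => [|[|[|[|[|[|//]]]]]] // _ wb; first by rewrite D eqxx in wb.
all: rewrite !big_ord_recl !big_ord0 /= /bump /= ?add1n /pf_cofactor /pf4 /=.
all: case: j j6 => [|[|[|[|[|[|//]]]]]] _.
all: rewrite ?D ?(A 1 0)%N ?(A 2 0)%N ?(A 2 1)%N ?(A 3 0)%N ?(A 3 1)%N ?(A 3 2)%N ?(A 4 0)%N ?(A 4 1)%N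
  ?(A 4 2)%N ?(A 4 3)%N ?(A 5 0)%N ?(A 5 1)%N ?(A 5 2)%N ?(A 5 3)%N ?(A 5 4)%N.
all: clear; rewrite ?(mul0r, mulr0, add0r, addr0); intros; lra.
Qed.

End Pfaffian.

(** * The Euclidean product *)

Section Dot.
Context {R : realType}.

Lemma dotE n (u v : 'rV[R]_n) : dot u v = (u *m v^T) 0 0.
Proof. by rewrite mxE; apply: eq_bigr => i _; rewrite mxE. Qed.

Lemma dotC n (u v : 'rV[R]_n) : dot u v = dot v u.
Proof. by apply: eq_bigr => i _; rewrite mulrC. Qed.

Lemma dotDl n (u v w : 'rV[R]_n) : dot (u + v) w = dot u w + dot v w.
Proof. by rewrite !dotE mulmxDl mxE. Qed.

Lemma dotZl n a (u w : 'rV[R]_n) : dot (a *: u) w = a * dot u w.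
Proof. by rewrite !dotE -scalemxAl mxE. Qed.

Lemma dotNl n (u w : 'rV[R]_n) : dot (- u) w = - dot u w.
Proof. by rewrite !dotE mulNmx mxE. Qed.

Lemma dotBl n (u v w : 'rV[R]_n) : dot (u - v) w = dot u w - dot v w.
Proof. by rewrite dotDl dotNl. Qed.

Lemma dotDr n (u v w : 'rV[R]_n) : dot w (u + v) = dot w u + dot w v.
Proof. by rewrite !(dotC w) dotDl. Qed.

Lemma dotZr n a (u w : 'rV[R]_n) : dot w (a *: u) = a * dot w u.
Proof. by rewrite !(dotC w) dotZl. Qed.

Lemma dotBr n (u v w : 'rV[R]_n) : dot w (u - v) = dot w u - dot w v.
Proof. by rewrite !(dotC w) dotBl. Qed.

Lemma dot_ge0 n (u : 'rV[R]_n) : 0 <= dot u u.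
Proof. by apply: sumr_ge0 => i _; rewrite -expr2 sqr_ge0. Qed.

Lemma dot_eq0 n (u : 'rV[R]_n) : dot u u = 0 -> u = 0.
Proof.
move=> /eqP; rewrite psumr_eq0 => [/allP H|i _]; last by rewrite -expr2 sqr_ge0.
apply/rowP => i; have := H i (mem_index_enum _).
by rewrite -expr2 sqrf_eq0 mxE => /eqP.
Qed.

Lemma dot_gt0 n (u : 'rV[R]_n) : u != 0 -> 0 < dot u u.
Proof.
move=> u0; rewrite lt0r dot_ge0 andbT; apply/eqP => /dot_eq0 E.
by rewrite E eqxx in u0.
Qed.

Lemma smooth_on_dot (V : normedModType R) (U : set V) n (F G : V -> 'rV[R]_n) :
  open U -> smooth_on U F -> smooth_on U G -> smooth_on U (fun x => dot (F x) (G x)).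
Proof.
move=> oU /(smooth_on_mxP oU) sF /(smooth_on_mxP oU) sG.
by apply: smooth_on_sum => // i _; apply: smooth_onM.
Qed.

Lemma smooth_on_scale (V : normedModType R) (U : set V) m n (f : V -> R) (F : V -> 'M[R]_(m, n)) :
  open U -> smooth_on U f -> smooth_on U F -> smooth_on U (fun x => f x *: F x).
Proof.
move=> oU sf /(smooth_on_mxP oU) sF; apply/smooth_on_mxP => // i j.
rewrite (_ : (fun _ => _) = fun x => f x * F x i j); first exact: smooth_onM.
by apply/funext => x; rewrite mxE.
Qed.

Lemma smooth_on_mxD (V : normedModType R) (U : set V) m n (F G : V -> 'M[R]_(m, n)) :
  open U -> smooth_on U F -> smooth_on U G -> smooth_on U (fun x => F x + G x).
Proof.
move=> oU /(smooth_on_mxP oU) sF /(smooth_on_mxP oU) sG; apply/smooth_on_mxP => // i j.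
rewrite (_ : (fun _ => _) = fun x => F x i j + G x i j); first exact: smooth_onD.
by apply/funext => x; rewrite mxE.
Qed.

Lemma smooth_on_mxcst (V : normedModType R) (U : set V) m n (A : 'M[R]_(m, n)) :
  open U -> smooth_on U (fun=> A).
Proof. by move=> oU; apply/smooth_on_mxP => // i j; exact: smooth_on_cst. Qed.

Lemma smooth_on_coord n (U : set 'rV[R]_n) i : open U -> smooth_on U (fun x : 'rV[R]_n => x 0 i).
Proof.
move=> oU; pose P (f : 'rV[R]_n -> R) := f = (fun x => x 0 i) \/ exists c, f = cst c.
apply: (@smooth_on_coind _ _ _ U P) => //; last by left.
  by move=> _ [->|[c ->]] x _; [exact: differentiable_coord|exact: differentiable_cst].
move=> _ [->|[c ->]] v; last first.
  by exists (cst 0); [right; exists 0|move=> x _; rewrite derive_cst].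
exists (cst (v 0 i)); first by right; exists (v 0 i).
move=> x _; have /= := @derive_mxE _ _ _ _ (@id 'rV[R]_n) x v 0 i _.
by rewrite derive_id => <- //; exact: ex_diff.
Qed.

Lemma smooth_on_id n (U : set 'rV[R]_n) : open U -> smooth_on U (@id 'rV[R]_n).
Proof. by move=> oU; apply/smooth_on_mxP => // i j; rewrite ord1; exact: smooth_on_coord. Qed.

Lemma derive_mulmx (V : normedModType R) m n p (F : V -> 'M[R]_(m, n)) (G : V -> 'M[R]_(n, p)) x v :
  differentiable F x -> differentiable G x ->
  'D_v (fun y => F y *m G y) x = 'D_v F x *m G x + F x *m 'D_v G x.
Proof.
move=> dF dG; have dF' := (differentiable_mxP _ _).1 dF; have dG' := (differentiable_mxP _ _).1 dG.
have E i j : (fun y => (F y *m G y) i j) = \sum_k (fun y => F y i k) * (fun y => G y k j).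
  by apply/funext => y; rewrite mxE fct_sumE.
have dFG : differentiable (fun y => F y *m G y) x.
  apply/differentiable_mxP => i j; rewrite E; apply: differentiable_sum => k.
  exact: differentiableM.
apply/matrixP => i j; rewrite (derive_mxE _ _ _ dFG) E derive_sum => [|k]; last first.
  by apply: derivableM; exact: diff_derivable.
rewrite !mxE -big_split /=; apply: eq_bigr => k _.
rewrite deriveM; [|exact: diff_derivable|exact: diff_derivable].
by rewrite !derive_mxE // addrC; congr (_ + _); exact: mulrC.
Qed.

Lemma derive_dot (V : normedModType R) n (F G : V -> 'rV[R]_n) x v :
  differentiable F x -> differentiable G x ->
  'D_v (fun y => dot (F y) (G y)) x = dot ('D_v F x) (G x) + dot (F x) ('D_v G x).
Proof.
move=> dF dG; have dF' := (differentiable_mxP _ _).1 dF; have dG' := (differentiable_mxP _ _).1 dG.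
have -> : (fun y => dot (F y) (G y)) = \sum_k (fun y => F y 0 k) * (fun y => G y 0 k).
  by apply/funext => y; rewrite fct_sumE.
rewrite derive_sum => [|k]; last by apply: derivableM; exact: diff_derivable.
rewrite -big_split /=; apply: eq_bigr => k _.
rewrite deriveM; [|exact: diff_derivable|exact: diff_derivable].
by rewrite !derive_mxE // addrC; congr (_ + _); exact: mulrC.
Qed.

End Dot.

(** * Calculus on the sphere *)

Section Sphere.
Context {R : realType} {n : nat}.
Local Notation S := (sphere R n).
Local Notation E := 'rV[R]_n.+1.

Definition punctured : set E := [set x | x != 0].

Lemma open_punctured : open punctured.
Proof.
rewrite (_ : punctured = ~` [set 0]); first exact/closed_openC/accessible_closed_set1/hausdorff_accessible/norm_hausdorff.
by apply/seteqP; split=> x /= /eqP.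
Qed.

Lemma sphere_dot (p : S) : dot (val p) (val p) = 1.
Proof. by apply/eqP; exact: (valP p). Qed.

Lemma sphere_neq0 (p : S) : val p != 0.
Proof.
apply/eqP => p0; have := sphere_dot p.
by rewrite p0 -(scale0r 0) dotZl mul0r => /eqP; rewrite eq_sym oner_eq0.
Qed.

Definition invnorm (x : E) : R := (Num.sqrt (dot x x))^-1.

Lemma invnorm_sqr (x : E) : x != 0 -> invnorm x ^+ 2 = (dot x x)^-1.
Proof. by move=> x0; rewrite /invnorm exprVn sqr_sqrtr // dot_ge0. Qed.

Lemma val_radial (x : E) : x != 0 -> val (radial x) = invnorm x *: x.
Proof.
move=> x0; rewrite /radial val_insubd dotZl dotZr mulrA -expr2.
by rewrite -/(invnorm x) invnorm_sqr // mulVf ?eqxx // gt_eqF // dot_gt0.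
Qed.

Lemma invnorm_val (p : S) : invnorm (val p) = 1.
Proof. by rewrite /invnorm sphere_dot sqrtr1 invr1. Qed.

Lemma radialK (p : S) : radial (val p) = p.
Proof. by apply: val_inj; rewrite val_radial ?sphere_neq0 // invnorm_val scale1r. Qed.

Lemma invnorm_derive (x v : E) : x != 0 ->
  differentiable invnorm x /\ 'D_v invnorm x = - (dot x v / dot x x) * invnorm x.
Proof.
move=> x0; have q0 := dot_gt0 x0.
have dq : differentiable (fun y : E => dot y y) x.
  apply: (@smooth_on_differentiable _ _ _ setT) => //.
  by apply: smooth_on_dot; [exact: openT|exact: smooth_on_id openT|exact: smooth_on_id openT].
have [d1 d2] := is_derive1_sqrt q0.
have ds : differentiable (@Num.sqrt R \o (fun y : E => dot y y)) x.
  by apply: differentiable_comp => //; apply/derivable1_diffP.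
have s0 : Num.sqrt (dot x x) != 0 by rewrite gt_eqF // sqrtr_gt0.
split; first exact: differentiableV.
rewrite [LHS](@deriveV _ _ (@Num.sqrt R \o (fun y : E => dot y y)) x v s0 (diff_derivable ds)).
have -> : 'D_v (@Num.sqrt R \o (fun y : E => dot y y)) x = dot x v / Num.sqrt (dot x x).
  have ds' : differentiable (@Num.sqrt R) (dot x x) by exact/derivable1_diffP.
  rewrite deriveE // diff_comp //= -(deriveE _ dq).
  have -> : 'D_v (fun y : E => dot y y) x = (2 * dot x v) *: 1.
    rewrite (derive_dot v (@ex_diff _ _ _ _ _ _ _ (is_diff_id x)) (@ex_diff _ _ _ _ _ _ _ (is_diff_id x))).
    by rewrite derive_id (dotC v) /GRing.scale /= mulr1; ring.
  rewrite linearZ /= -(deriveE _ ds') d2 /GRing.scale /=.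
  by field.
rewrite /invnorm /GRing.scale /= -exprVn.
by rewrite -{3}(sqr_sqrtr (ltW q0)); field.
Qed.

(** Every derivative of [g * invnorm] with smooth [g] is again of this form. *)
Lemma smooth_on_invnorm : smooth_on punctured invnorm.
Proof.
pose P (h : E -> R) := exists2 g : E -> R, smooth_on punctured g & h = fun x => g x * invnorm x.
apply: (@smooth_on_coind _ _ _ punctured P); first exact: open_punctured.
- move=> _ [g sg ->] x x0; apply: differentiableM.
    exact: smooth_on_differentiable sg x0.
  exact: (invnorm_derive 0 x0).1.
- move=> _ [g sg ->] v.
  exists (fun x => ('D_v g x + - (g x * (dot x v * (dot x x)^-1))) * invnorm x).
    exists (fun x => 'D_v g x + - (g x * (dot x v * (dot x x)^-1))) => //.
    have oP := open_punctured.
    apply: smooth_onD => //; first exact: smooth_on_derive.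
    apply: smooth_onN => //; apply: smooth_onM => //; apply: smooth_onM => //.
      by apply: smooth_on_dot => //; [exact: smooth_on_id|exact: smooth_on_mxcst].
    apply: smooth_onV => //; last by move=> x /dot_gt0 /lt0r_neq0.
    by apply: smooth_on_dot => //; exact: smooth_on_id.
  move=> x x0; have [d1 d2] := invnorm_derive v x0.
  rewrite deriveM; [|exact/diff_derivable/(smooth_on_differentiable sg x0)|exact: diff_derivable].
  by rewrite d2 /GRing.scale /=; ring.
- exists (cst 1); first exact: smooth_on_cst.
  by apply/funext => x; rewrite mul1r.
Qed.

Lemma smooth_on_radial : smooth_on punctured (fun x : E => val (radial x)).
Proof.
have oP := open_punctured.
apply: (@smooth_on_eq _ _ _ _ (fun x => invnorm x *: x)) => //; last first.
  by move=> x /val_radial.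
by apply: smooth_on_scale => //; [exact: smooth_on_invnorm|exact: smooth_on_id].
Qed.

Lemma derive_radial (p : S) v : tangent p v ->
  'D_v (fun x : E => val (radial x)) (val p) = v.
Proof.
move=> tv; have p0 := sphere_neq0 p; have [d1 d2] := invnorm_derive v p0.
rewrite (@near_eq_derive _ _ _ _ (fun x => invnorm x *: x)); last first.
  by apply: (open_near_eq open_punctured) => // x /val_radial.
apply/rowP => i; rewrite derive_mxE; last first.
  by apply: smooth_on_differentiable p0; apply: smooth_on_scale;
    [exact: open_punctured|exact: smooth_on_invnorm|exact/smooth_on_id/open_punctured].
rewrite (_ : (fun _ => _) = invnorm * (fun x : E => x 0 i)); last first.
  by apply/funext => x; rewrite mxE.
have di : differentiable (fun x : E => x 0 i) (val p) by exact: differentiable_coord.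
rewrite deriveM; [|exact: diff_derivable|exact: diff_derivable].
rewrite d2 (tv : dot _ _ = 0) mul0r oppr0 mul0r scaler0 addr0 invnorm_val scale1r.
have /= <- := @derive_mxE _ _ _ _ (@id E) (val p) v 0 i (ex_diff).
by rewrite derive_id.
Qed.

(** Smoothness on the sphere is smoothness of the degree-0 homogeneous
    extension, so that all calculus can take place in the ambient space. *)
Lemma smoothP_mx m k (f : S -> 'M[R]_(m, k)) :
  smooth f <-> smooth_on punctured (f \o @radial R n).
Proof.
have oP := open_punctured.
split=> [sf s x x0|sf p]; last first.
  exists punctured, (f \o @radial R n); split=> //; first exact: sphere_neq0.
  by move=> q _ /=; rewrite radialK.
have [U [F [oU Up sF UF]]] := sf (radial x).
pose V := punctured `&` (fun x : E => val (radial x)) @^-1` U.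
have oV : open V.
  rewrite openE => y [y0 Uy]; rewrite /interior /=; apply: filterI.
    exact: open_nbhs_nbhs.
  apply: (differentiable_continuous (smooth_on_differentiable smooth_on_radial y0)).
  exact: open_nbhs_nbhs.
suff : smooth_on V (f \o @radial R n) by apply.
apply: (@smooth_on_eq _ _ _ _ (fun x => F (val (radial x)))) => //; last first.
  by move=> y [y0 Uy] /=; exact: UF.
apply/smooth_on_mxP => // i j.
apply: (@smooth_on_comp _ _ V oV _ U (fun z => F z i j) (fun x : E => val (radial x))).
- by move/(smooth_on_mxP oU): sF => sF; exact: sF.
- by move=> y [].
- move=> l; have /(smooth_on_mxP oV) := smooth_onS (fun y (h : V y) => h.1) smooth_on_radial.
  exact.
Qed.

Lemma smooth_radial_differentiable m k (f : S -> 'M[R]_(m, k)) (x : E) : smooth f ->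
  x != 0 -> differentiable (f \o @radial R n) x.
Proof. by move=> /smoothP_mx sf; exact: smooth_on_differentiable sf. Qed.

(** * The Levi-Civita connection of the round sphere *)

Definition tproj (p : S) : 'M[R]_n.+1 := 1%:M - (val p)^T *m val p.

Lemma mul_tproj (p : S) v : v *m tproj p = v - dot v (val p) *: val p.
Proof.
rewrite mulmxBr mulmx1 mulmxA dotE; congr (_ - _).
by rewrite [v *m _]mx11_scalar mul_scalar_mx !mxE.
Qed.

Lemma tproj_tangent (p : S) v : tangent p (v *m tproj p).
Proof.
by rewrite /tangent mul_tproj dotBr dotZr sphere_dot mulr1 dotC subrr.
Qed.

Lemma tproj_id (p : S) v : tangent p v -> v *m tproj p = v.
Proof. by move=> tv; rewrite mul_tproj dotC (tv : dot _ _ = 0) scale0r subr0. Qed.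

Lemma smooth_on_tproj : smooth_on punctured (fun x : E => tproj (radial x)).
Proof.
have oP := open_punctured; have sr := smooth_on_radial.
apply: smooth_on_mxD => //; first exact: smooth_on_mxcst.
rewrite (_ : (fun _ => _) = fun x => -1 *: ((val (radial x))^T *m val (radial x))); last first.
  by apply/funext => x; rewrite scaleN1r.
apply: smooth_on_scale => //; first exact: smooth_on_cst.
by apply: smooth_on_mulmx => //; exact: smooth_on_trmx.
Qed.

Lemma dot_tproj (p : S) u v : tangent p v -> dot (u *m tproj p) v = dot u v.
Proof. by move=> tv; rewrite mul_tproj dotBl dotZl (tv : dot _ _ = 0) mulr0 subr0. Qed.

(** The tangential part of a constant field: a global vector field with any
    prescribed tangent value at a point. *)
Definition cfield (c : E) : S -> E := fun q => c *m tproj q.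

Lemma cfield_vfield c : vfield (cfield c).
Proof.
split; last by move=> p; exact: tproj_tangent.
apply/smoothP_mx; apply: smooth_on_mulmx; first exact: open_punctured.
  exact/smooth_on_mxcst/open_punctured.
exact: smooth_on_tproj.
Qed.

Lemma sderive_dot (Y Z : S -> E) p v : smooth Y -> smooth Z ->
  sderive (fun q => dot (Y q) (Z q)) p v
  = dot (sderive Y p v) (Z p) + dot (Y p) (sderive Z p v).
Proof.
move=> sY sZ; have p0 := sphere_neq0 p.
rewrite /sderive (derive_dot (F := Y \o @radial R n) (G := Z \o @radial R n)) /= ?radialK //.
  exact: smooth_radial_differentiable.
exact: smooth_radial_differentiable.
Qed.

Lemma sderive_tangent_field (Y : S -> E) p v : vfield Y -> tangent p v ->
  dot (val p) (sderive Y p v) = - dot v (Y p).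
Proof.
move=> [sY tY] tv; have p0 := sphere_neq0 p.
have dY := smooth_radial_differentiable sY p0.
have dr := smooth_on_differentiable smooth_on_radial p0.
have := derive_dot v dr dY; rewrite derive_radial //= radialK.
rewrite (_ : (fun _ => _) = cst 0); last by apply/funext => y; exact: tY.
by rewrite derive_cst => /esym/eqP; rewrite addrC addr_eq0 => /eqP.
Qed.

(** The tangential part of the flat derivative is also torsion-free and metric.
    The difference of the two connections gives a trilinear form that is
    symmetric in its first two arguments and skew in its last two, hence zero. *)
Lemma levi_civitaE (nabla : (S -> E) -> S -> E -> E) Y p v :
  levi_civita nabla -> vfield Y -> tangent p v ->
  nabla Y p v = sderive Y p v *m tproj p.
Proof.
move=> [[tN _ _ _ _] tor met] vY tv.
pose T X Y := nabla Y p (X p) - sderive Y p (X p) *m tproj p.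
have Tt X Z : vfield X -> vfield Z -> tangent p (T X Z).
  move=> [_ tX] vZ; rewrite /tangent dotBr.
  have := tproj_tangent p (sderive Z p (X p)); rewrite /tangent => ->.
  by rewrite (tN Z p (X p) vZ (tX p) : dot _ _ = 0) subrr.
have Tsym X Z : vfield X -> vfield Z -> T X Z = T Z X.
  move=> vX vZ; have tX := vX.2; have tZ := vZ.2.
  have b : tangent p (bracket X Z p).
    by rewrite /tangent dotBr !sderive_tangent_field // dotC subrr.
  have H : nabla Z p (X p) - nabla X p (Z p) =
      sderive Z p (X p) *m tproj p - sderive X p (Z p) *m tproj p.
    by rewrite tor // -mulmxBl tproj_id.
  apply/eqP; rewrite /T -subr_eq0 opprB addrACA (addrC (- _)) -addrACA -opprB.
  by rewrite opprB H addrC subrKA subrr.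
have Tskew X Z Z' : vfield X -> vfield Z -> vfield Z' ->
    dot (T X Z) (Z' p) + dot (Z p) (T X Z') = 0.
  move=> vX vZ vZ'; have tX := vX.2 p.
  have := met Z Z' p (X p) vZ vZ' tX.
  rewrite (sderive_dot _ _ vZ.1 vZ'.1) /T dotBl dotBr (dot_tproj _ (vZ'.2 p)).
  rewrite (dotC (Z p) (_ *m _)) (dot_tproj _ (vZ.2 p)) (dotC _ (Z p)).
  by move=> E0; rewrite addrACA -opprD E0 subrr.
(* By symmetry and skewness <T(X, Z), Z'> is its own opposite; the test field Z'
   extends the vector T(X, Z). *)
have T0 X Z : vfield X -> vfield Z -> T X Z = 0.
  move=> vX vZ; apply: dot_eq0.
  pose Z' := cfield (T X Z); have vZ' : vfield Z' := cfield_vfield _.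
  have -> : dot (T X Z) (T X Z) = dot (T X Z) (Z' p).
    by rewrite /Z' /cfield tproj_id //; exact: Tt.
  have A := Tskew X Z Z' vX vZ vZ'.
  have B := Tskew Z' X Z vZ' vX vZ.
  have C := Tskew Z Z' X vZ vZ' vX.
  rewrite (Tsym Z X) // (Tsym Z' X) // (Tsym Z Z') // in A B C *.
  move: A B C; rewrite !(dotC (Z p)) !(dotC (X p)) !(dotC (Z' p)); lra.
have := T0 (cfield v) Y (cfield_vfield v) vY.
by rewrite /T /cfield tproj_id // => /eqP; rewrite subr_eq0 => /eqP.
Qed.

(** * Strong integrability in terms of the derivative of the matrix *)

Lemma mulmx_row_inj m k (A B : 'M[R]_(m, k)) :
  (forall u : 'rV[R]_m, u *m A = u *m B) -> A = B.
Proof. by move=> H; apply/row_matrixP => i; rewrite !rowE H. Qed.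

Section AlmostComplex.
Variables (J : S -> 'M[R]_n.+1) (JC : almost_complex J).

Lemma tproj_J p : tproj p *m J p = J p.
Proof.
have [_ /(_ p)[pJ _] _] := JC.
by rewrite mulmxBl mul1mx -mulmxA pJ mulmx0 subr0.
Qed.

Lemma J_tangent p u : tangent p (u *m J p).
Proof.
have [_ /(_ p)[_ tJ] _] := JC.
by rewrite -tproj_J mulmxA; apply: tJ; exact: tproj_tangent.
Qed.

Lemma J_tproj p : J p *m tproj p = J p.
Proof. by apply: mulmx_row_inj => u; rewrite mulmxA tproj_id //; exact: J_tangent. Qed.

Lemma J_sqr p : J p *m J p = - tproj p.
Proof.
have [_ _ JJ] := JC; apply: mulmx_row_inj => u.
by rewrite -{1}(tproj_J p) !mulmxA JJ ?mulmxN //; exact: tproj_tangent.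
Qed.

(** The derivative of the vector field itself cancels, since [J] annihilates the
    normal direction on both sides. *)
Lemma nabla_endoE (nabla : (S -> E) -> S -> E -> E) p v y :
  levi_civita nabla -> tangent p v -> tangent p y ->
  nabla_endo nabla J p v (cfield y) = y *m sderive J p v *m tproj p.
Proof.
move=> LC tv ty; have [sJ _ _] := JC; have p0 := sphere_neq0 p.
have [sY tY] := cfield_vfield y.
have vJ : vfield (fun q => cfield y q *m J q).
  split=> [|q]; last exact: J_tangent.
  apply/smoothP_mx; apply: smooth_on_mulmx; first exact: open_punctured.
    by move/smoothP_mx: sY.
  by move/smoothP_mx: sJ.
rewrite /nabla_endo (levi_civitaE LC vJ tv) (levi_civitaE LC (cfield_vfield y) tv).
have -> : sderive (fun q => cfield y q *m J q) p v =
    sderive (cfield y) p v *m J p + y *m sderive J p v.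
  rewrite /sderive (derive_mulmx v (F := cfield y \o @radial R n) (G := J \o @radial R n)).
  - by rewrite /= radialK /cfield tproj_id.
  - exact: smooth_radial_differentiable.
  - exact: smooth_radial_differentiable.
by rewrite mulmxDl -!(mulmxA (sderive _ _ _)) J_tproj tproj_J addrAC subrr add0r.
Qed.

Lemma strongly_integrable_sderive (nabla : (S -> E) -> S -> E -> E) p v y :
  levi_civita nabla -> strongly_integrable nabla J ->
  tangent p v -> tangent p y ->
  y *m sderive J p (v *m J p) *m tproj p = y *m sderive J p v *m J p.
Proof.
move=> LC SI tv ty; have := SI p v (cfield y) tv (cfield_vfield y).
rewrite (nabla_endoE LC (J_tangent p v) ty) (nabla_endoE LC tv ty) => H.
by apply: (etrans H); rewrite -(mulmxA _ (tproj p)) tproj_J.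
Qed.

End AlmostComplex.

End Sphere.

(** * Algebra of a differentiated projection *)
Section ProjectionAlgebra.
Context {R : realFieldType} {m : nat}.
Variables (I N : 'M[R]_m).
Hypotheses (NN : N *m N = N) (IN : I *m N = N *m I).

(** The linearization of [N *m N = N]: a solution exchanges the image and the
    kernel of [N]. *)
Definition proj_variation (A : 'M[R]_m) := A = A *m N + N *m A.

Lemma variation_swap A : proj_variation A -> N *m A = A *m (1%:M - N).
Proof. by move=> vA; rewrite mulmxBr mulmx1 {2}vA addrAC subrr add0r. Qed.

Lemma variation_swapC A : proj_variation A -> (1%:M - N) *m A = A *m N.
Proof. by move=> vA; rewrite mulmxBl mul1mx {1}vA addrK. Qed.

Lemma compNN : (1%:M - N) *m N = 0.
Proof. by rewrite mulmxBl mul1mx NN subrr. Qed.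

Lemma compNr : N *m (1%:M - N) = 0.
Proof. by rewrite mulmxBr mulmx1 NN subrr. Qed.

Lemma trace_corner (P X : 'M[R]_m) : I *m P = P *m I -> P *m X *m P = 0 ->
  \tr (I *m X *m P *m P) = 0.
Proof.
move=> IP PXP; rewrite mxtrace_mulC !mulmxA -IP.
by rewrite -!(mulmxA I) PXP mulmx0 mxtrace0.
Qed.

(** A product of three maps that exchange image and kernel exchanges them too,
    so it has no diagonal block. *)
Lemma trace_variation3 A B C : proj_variation A -> proj_variation B -> proj_variation C ->
  \tr (I *m (A *m B *m C)) = 0.
Proof.
move=> vA vB vC; set X := A *m B *m C.
have XN : N *m X *m N = 0.
  rewrite /X !mulmxA (variation_swap vA) -!mulmxA -(variation_swapC vC) !mulmxA.
  by rewrite -(mulmxA A) (variation_swapC vB) -!mulmxA (mulmxA N) compNr mul0mx !mulmx0.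
have X1 : (1%:M - N) *m X *m (1%:M - N) = 0.
  rewrite /X !mulmxA (variation_swapC vA) -!mulmxA -(variation_swap vC) !mulmxA.
  by rewrite -(mulmxA A) (variation_swap vB) -!mulmxA (mulmxA (1%:M - N)) compNN mul0mx !mulmx0.
have -> : I *m X = I *m X *m N *m N + I *m X *m (1%:M - N) *m (1%:M - N).
  rewrite -!(mulmxA (I *m X)) NN mulmxBr mulmx1 compNN subr0.
  by rewrite -mulmxDr addrC subrK mulmx1.
have IN1 : I *m (1%:M - N) = (1%:M - N) *m I by rewrite mulmxBr mulmxBl mulmx1 mul1mx IN.
by rewrite mxtraceD !trace_corner // addr0.
Qed.

Hypotheses (NT : N^T = N) (IT : I^T = - I) (II : I *m I = - 1%:M).

Lemma trace_form_skew A B : A^T = A -> B^T = B ->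
  \tr (I *m N *m A *m B) = - \tr (I *m N *m B *m A).
Proof.
move=> AT BT; rewrite -mxtrace_tr !trmx_mul AT BT NT IT !mulmxN linearN /=; congr (- _).
by rewrite mulmxA mxtrace_mulC -IN !mulmxA.
Qed.

Definition offdiag (A : 'M[R]_m) := (1%:M - N) *m A *m N.

(** In terms of the off-diagonal block the trace form is, up to sign, the
    imaginary part of a Hermitian product. *)
Lemma trace_form_offdiag A B : A^T = A -> proj_variation A ->
  \tr (I *m N *m A *m B) = \tr (I *m ((offdiag A)^T *m offdiag B)).
Proof.
move=> AT vA; rewrite /offdiag !trmx_mul AT NT linearB /= trmx1 NT.
have N1 : (1%:M - N) *m (1%:M - N) = 1%:M - N by rewrite mulmxBl mul1mx compNr subr0.
have -> : N *m (A *m (1%:M - N)) *m ((1%:M - N) *m B *m N) = N *m A *m B *m N.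
  rewrite -(variation_swap vA) (mulmxA N N) NN (variation_swap vA) !mulmxA.
  by rewrite -(mulmxA A) N1 -(variation_swap vA).
by rewrite [in RHS]mulmxA [RHS]mxtrace_mulC !mulmxA -IN -(mulmxA I N N) NN.
Qed.

Lemma trace_sqr_eq0 (B : 'M[R]_m) : \tr (B^T *m B) = 0 -> B = 0.
Proof.
rewrite /mxtrace => /eqP; rewrite psumr_eq0 => [/allP H|i _]; last first.
  by rewrite mxE; apply: sumr_ge0 => k _; rewrite mxE -expr2 sqr_ge0.
apply/matrixP => i j; have := H j (mem_index_enum _).
rewrite mxE psumr_eq0 => [/allP H'|k _]; last by rewrite mxE -expr2 sqr_ge0.
by have := H' i (mem_index_enum _); rewrite !mxE -expr2 sqrf_eq0 => /eqP.
Qed.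

(** For [B] the image of [A] under the complex structure, the form is minus the
    squared norm of the off-diagonal block of [A]. *)
Lemma trace_form_neq0 A B : A^T = A -> proj_variation A ->
  offdiag B = offdiag A *m I -> offdiag A != 0 -> \tr (I *m N *m A *m B) != 0.
Proof.
move=> AT vA BA; apply: contraNneq; rewrite trace_form_offdiag // BA.
rewrite (mulmxA _^T) mxtrace_mulC -(mulmxA _ I I) II mulmxN mulmx1 linearN /=.
by move=> /eqP; rewrite oppr_eq0 => /eqP /trace_sqr_eq0 ->.
Qed.

End ProjectionAlgebra.

(** * The projection attached to a complex structure *)

Section TwistorAlgebra.
Context {R : realFieldType} {n : nat}.
Variables (p : 'rV[R]_n) (J : 'M[R]_n).
Local Notation Pr := (1%:M - p^T *m p).
Hypotheses (pp : p *m p^T = 1%:M) (pJ : p *m J = 0) (Jp : J *m p^T = 0)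
  (JJ : J *m J = - Pr).

(** On row vectors (a, b), standing for a + i b, the kernel of [tw_K] is spanned
    over C by p and the X + i XJ: this is the quotient of C^n by W_p, identified
    with the tangent space. *)
Definition tw_K : 'M[R]_(n + n, n) := col_mx (- J) Pr.
(** The Gram matrix of [tw_K], completed by 1 on the normal line. *)
Definition tw_M : 'M[R]_n := 1%:M + J^T *m J.
(** The orthogonal projection onto the orthogonal complement of W_p. *)
Definition tw_N : 'M[R]_(n + n) := tw_K *m (invmx tw_M *m tw_K^T).
(** Multiplication by i: (a, b) |-> (- b, a). *)
Definition tw_I : 'M[R]_(n + n) := block_mx 0 1%:M (- 1%:M) 0.
Local Notation K := tw_K.
Local Notation M := tw_M.
Local Notation N := tw_N.
Local Notation I := tw_I.

Lemma Prp : Pr *m p^T = 0.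
Proof. by rewrite mulmxBl mul1mx -mulmxA pp mulmx1 subrr. Qed.

Lemma pPr : p *m Pr = 0.
Proof. by rewrite mulmxBr mulmx1 mulmxA pp mul1mx subrr. Qed.

Lemma PrT : Pr^T = Pr.
Proof. by rewrite linearB /= trmx1 trmx_mul trmxK. Qed.

Lemma PrPr : Pr *m Pr = Pr.
Proof. by rewrite {1}mulmxBl mul1mx -mulmxA pPr mulmx0 subr0. Qed.

Lemma PrJ : Pr *m J = J.
Proof. by rewrite mulmxBl mul1mx -mulmxA pJ mulmx0 subr0. Qed.

Lemma JPr : J *m Pr = J.
Proof. by rewrite mulmxBr mulmx1 mulmxA Jp mul0mx subr0. Qed.

Lemma tw_M_unit : M \in unitmx.
Proof.
rewrite -row_free_unit -kermx_eq0; apply/eqP/row_matrixP => i; rewrite row0.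
set u := row i _.
have uM : u *m M = 0 by rewrite /u -row_mul mulmx_ker row0.
move: u uM => {i} u uM.
have : (u *m M *m u^T) 0 0 = 0 by rewrite uM mul0mx mxE.
have -> : u *m M *m u^T = u *m u^T + (u *m J^T) *m (u *m J^T)^T.
  by rewrite mulmxDr mulmx1 mulmxDl trmx_mul trmxK !mulmxA.
rewrite mxE.
have sq (w : 'rV[R]_n) : 0 <= (w *m w^T) 0 0.
  by rewrite mxE; apply: sumr_ge0 => k _; rewrite mxE -expr2 sqr_ge0.
move=> H; have : (u *m u^T) 0 0 = 0 by have := sq u; have := sq (u *m J^T); lra.
move/eqP; rewrite mxE psumr_eq0 => [/allP H'|k _]; last by rewrite mxE -expr2 sqr_ge0.
apply/rowP => k; have := H' k (mem_index_enum _).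
by rewrite mxE -expr2 sqrf_eq0 => /eqP ->; rewrite mxE.
Qed.

Lemma tw_KTK : K^T *m K = M - p^T *m p.
Proof.
rewrite /K tr_col_mx mul_row_col PrT PrPr [(- J)^T]linearN /= mulNmx mulmxN opprK.
by rewrite /M addrCA addrA.
Qed.

Lemma tw_Kp : K *m p^T = 0.
Proof. by rewrite mul_col_mx mulNmx Jp Prp oppr0 col_mx0. Qed.

Lemma tw_pM : p *m M = p.
Proof.
rewrite mulmxDr mulmx1 mulmxA -[p *m J^T]trmxK trmx_mul trmxK Jp trmx0 mul0mx.
by rewrite addr0.
Qed.

Lemma tw_Mp : M *m p^T = p^T.
Proof. by rewrite mulmxDl mul1mx -mulmxA Jp mulmx0 addr0. Qed.

Lemma tw_pMi : p *m invmx M = p.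
Proof. by rewrite -{1}tw_pM -mulmxA mulmxV ?tw_M_unit // mulmx1. Qed.

Lemma tw_Mip : invmx M *m p^T = p^T.
Proof. by rewrite -{1}tw_Mp mulmxA mulVmx ?tw_M_unit // mul1mx. Qed.

Lemma tw_MT : M^T = M.
Proof. by rewrite linearD /= trmx1 trmx_mul trmxK. Qed.

Lemma tw_MiKTK : invmx M *m K^T *m K = Pr.
Proof. by rewrite -mulmxA tw_KTK mulmxBr mulVmx ?tw_M_unit // mulmxA tw_Mip. Qed.

Lemma tw_KPr : K *m Pr = K.
Proof. by rewrite mulmxBr mulmx1 mulmxA tw_Kp mul0mx subr0. Qed.

Lemma tw_NK : N *m K = K.
Proof. by rewrite -mulmxA tw_MiKTK tw_KPr. Qed.

Lemma tw_NN : N *m N = N.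
Proof. by rewrite {2}/N mulmxA tw_NK. Qed.

Lemma tw_NT : N^T = N.
Proof. by rewrite !trmx_mul trmxK trmx_inv tw_MT -mulmxA. Qed.

Lemma tw_IT : I^T = - I.
Proof.
by rewrite /I tr_block_mx !linear0 linearN /= trmx1 opp_block_mx opprK !oppr0.
Qed.

Lemma tw_II : I *m I = - 1%:M.
Proof.
rewrite /I mulmx_block !(mul0mx, mulmx0, mul1mx, mulmx1, mulNmx, mulmxN).
by rewrite !(add0r, addr0, oppr0) scalar_mx_block opp_block_mx oppr0.
Qed.

Lemma tw_IK : I *m K = K *m J.
Proof.
rewrite /I /K mul_block_col !mul0mx !mulNmx !mulmxN !mul1mx opprK addr0 add0r.
by rewrite mul_col_mx mulNmx JJ opprK PrJ.
Qed.

(** This is why the projection is complex linear: the Gram matrix intertwines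
    [J] and [- J^T], so its inverse compensates for [J] not being skew. *)
Lemma tw_MJ : M *m J = - (J^T *m M).
Proof.
have JTPr : J^T *m Pr = J^T by rewrite -{1}PrT -trmx_mul PrJ.
have JTJT : J^T *m J^T = - Pr by rewrite -trmx_mul JJ linearN /= PrT.
rewrite /M mulmxDl mulmxDr mul1mx mulmx1 -mulmxA JJ mulmxN JTPr.
by rewrite mulmxA JTJT mulNmx PrJ opprB.
Qed.

Lemma tw_KTI : invmx M *m K^T *m I = J *m invmx M *m K^T.
Proof.
have H : J *m invmx M = - (invmx M *m J^T).
  have := congr1 (fun X => invmx M *m X *m invmx M) tw_MJ.
  by rewrite mulmxN mulNmx !mulmxA mulVmx ?tw_M_unit // mul1mx -!mulmxA mulmxV ?tw_M_unit // mulmx1.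
rewrite H mulNmx -!mulmxA -trmx_mul -tw_IK trmx_mul tw_IT !mulmxN opprK //.
Qed.

Lemma tw_IN : I *m N = N *m I.
Proof. by rewrite /N mulmxA tw_IK -!(mulmxA K) tw_KTI !mulmxA. Qed.

Section Variation.
Variables (v : 'rV[R]_n) (dJv dJw : 'M[R]_n).
Local Notation w := (v *m J).
Hypotheses (tv : p *m v^T = 0) (pdJv : p *m dJv = - v *m J)
  (pdJw : p *m dJw = - w *m J).
Hypothesis SI : forall y : 'rV[R]_n, p *m y^T = 0 -> y *m dJw *m Pr = y *m dJv *m J.

(** The derivative of [tw_K] when p moves with velocity [u] and [J] with [dJ]. *)
Definition tw_dK (u : 'rV[R]_n) (dJ : 'M[R]_n) : 'M[R]_(n + n, n) :=
  col_mx (- dJ) (- (u^T *m p + p^T *m u)).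

(** Strong integrability as the Cauchy-Riemann equation of p |-> W_p: the second
    fundamental form of W_p is complex linear in the direction of motion.  On
    X + i XJ this is the hypothesis [SI]; on p it is the derivative of pJ = 0,
    and on i p the derivative of the tangential projection. *)
Lemma tw_holomorphic (z : 'rV[R]_(n + n)) : z *m K = 0 ->
  z *m tw_dK w dJw *m Pr = z *m tw_dK v dJv *m J.
Proof.
rewrite -[z]hsubmxK; set a := lsubmx z; set b := rsubmx z.
rewrite !mul_row_col !mulmxN => ab.
have wPr : w *m Pr = w by rewrite -mulmxA JPr.
have vPr : v *m Pr = v.
  by rewrite mulmxBr mulmx1 mulmxA -[v *m p^T]trmxK trmx_mul trmxK tv trmx0 mul0mx subr0.
have wJ : w *m J = - v by rewrite -mulmxA JJ mulmxN vPr.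
have [al Ea] : exists al : 'M[R]_(1,1), a = a *m Pr + al *m p.
  by exists (a *m p^T); rewrite mulmxBr mulmx1 mulmxA subrK.
have tX : p *m (a *m Pr)^T = 0.
  by rewrite trmx_mul PrT mulmxA pPr mul0mx.
rewrite !mulmxDl !mulNmx; congr (- _ - _).
  have H1 : p *m dJw *m Pr = v by rewrite pdJw mulNmx wJ opprK vPr.
  have H2 : p *m dJv *m J = v by rewrite pdJv mulNmx mulNmx wJ opprK.
  by rewrite Ea !mulmxDl SI // -!(mulmxA al) H1 H2.
rewrite -!(mulmxA b) !mulmxDl -!(mulmxA _ p) -!(mulmxA p^T) pPr pJ !mulmx0 !add0r wPr.
by [].
Qed.

(** Since [1 - N] kills [K], only the variation of the leftmost factor of [N]
    contributes to the off-diagonal block. *)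
Lemma tw_offdiag u dJ A X : A = tw_dK u dJ *m (invmx M *m K^T) + K *m X ->
  offdiag N A = (1%:M - N) *m tw_dK u dJ *m (invmx M *m K^T).
Proof.
move=> ->; rewrite /offdiag mulmxDr mulmxDl.
have K0 : (1%:M - N) *m K = 0 by rewrite mulmxBl mul1mx tw_NK subrr.
rewrite (mulmxA _ K) K0 !mul0mx addr0 -!mulmxA.
by rewrite -[K^T *m N]trmxK trmx_mul trmxK tw_NT tw_NK.
Qed.

Variables (Av Aw : 'M[R]_(n + n)).
Hypotheses (AvE : exists X, Av = tw_dK v dJv *m (invmx M *m K^T) + K *m X)
           (AwE : exists X, Aw = tw_dK w dJw *m (invmx M *m K^T) + K *m X).

Lemma tw_offdiag_J : offdiag N Aw = offdiag N Av *m I.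
Proof.
have [X1 E1] := AvE; have [X2 E2] := AwE.
rewrite (tw_offdiag E1) (tw_offdiag E2).
apply/row_matrixP => i; rewrite !row_mul; set z := row i _.
have zK : z *m K = 0.
  by rewrite /z -row_mul mulmxBl mul1mx tw_NK subrr row0.
have PrM : Pr *m (invmx M *m K^T) = invmx M *m K^T.
  rewrite mulmxBl mul1mx -mulmxA (mulmxA p) tw_pMi.
  by rewrite -[p *m K^T]trmxK trmx_mul trmxK tw_Kp trmx0 mulmx0 subr0.
rewrite -{1}PrM mulmxA (tw_holomorphic zK) -!mulmxA; congr (_ *m (_ *m _)).
by rewrite !mulmxA tw_KTI.
Qed.

(** The vector i p lies in W_p, and moving p by v moves it out of W_p, because v
    is real and the only real vectors in W_p are multiples of p. *)
Lemma tw_offdiag_neq0 : v != 0 -> offdiag N Av != 0.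
Proof.
have [X1 E1] := AvE; rewrite (tw_offdiag E1); apply: contraNneq => B0.
have z0 : row_mx 0 p *m K = 0 by rewrite mul_row_col mul0mx pPr addr0.
have zN : row_mx 0 p *m (1%:M - N) = row_mx 0 p :> 'rV_(n + n).
  by rewrite mulmxBr mulmx1 mulmxA z0 mul0mx subr0.
have zdK : row_mx 0 p *m tw_dK v dJv = - v.
  by rewrite mul_row_col mul0mx add0r mulmxN mulmxDr !mulmxA tv mul0mx add0r pp mul1mx.
have vPr : v *m Pr = v.
  by rewrite mulmxBr mulmx1 mulmxA -[v *m p^T]trmxK trmx_mul trmxK tv trmx0 mul0mx subr0.
have := congr1 (fun X => row_mx 0 p *m X *m K) B0.
rewrite mulmx0 mul0mx !mulmxA zN zdK -!(mulmxA (- v)) tw_MiKTK mulNmx vPr.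
by move/eqP; rewrite oppr_eq0.
Qed.

End Variation.

End TwistorAlgebra.

(** * The closed 2-form of a family of complex projections *)

Lemma schwarz_mx (R : realType) (V : normedModType R) (U : set V) m n
    (F : V -> 'M[R]_(m, n)) x u v : open U -> smooth_on U F -> U x ->
  'D_v ('D_u F) x = 'D_u ('D_v F) x.
Proof.
move=> oU sF Ux; apply/matrixP => i j.
have sE (k : V) : smooth_on U (fun y => 'D_k F y i j).
  by move: (smooth_on_derive k sF) => /(smooth_on_mxP oU); exact.
have DE k l y : U y -> 'D_l ('D_k F) y i j = 'D_l ('D_k (fun z => F z i j)) y.
  move=> Uy; rewrite (derive_mxE _ _ _ (smooth_on_differentiable (smooth_on_derive k sF) Uy)).
  apply: near_eq_derive; apply: (open_near_eq oU) => // z Uz.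
  by rewrite (derive_mxE _ _ _ (smooth_on_differentiable sF Uz)).
have E1 := DE u v x Ux.
have E2 := DE v u x Ux.
apply: (etrans E1).
apply: esym.
apply: (etrans E2).
apply: esym.
have sf : smooth_on U (fun z => F z i j) by move/(smooth_on_mxP oU): sF; exact.
apply: (schwarz oU Ux).
- by move=> y; exact: smooth_on_differentiable.
- by move=> y; apply: smooth_on_differentiable; exact: smooth_on_derive.
- by move=> y; apply: smooth_on_differentiable; exact: smooth_on_derive.
- apply: differentiable_continuous; apply: smooth_on_differentiable Ux.
  by do 2 apply: smooth_on_derive.
- apply: differentiable_continuous; apply: smooth_on_differentiable Ux.
  by do 2 apply: smooth_on_derive.
Qed.

Lemma derive_trmx (R : realType) (V : normedModType R) m n (F : V -> 'M[R]_(m, n)) x v :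
  differentiable F x -> ('D_v F x)^T = 'D_v (fun y => (F y)^T) x.
Proof.
move=> dF; have dT : differentiable (fun y => (F y)^T) x.
  apply/differentiable_mxP => i j; move/differentiable_mxP: dF => /(_ j i).
  by congr (differentiable _ x); apply/funext => y; rewrite mxE.
apply/matrixP => i j; rewrite mxE (derive_mxE _ _ _ dF) (derive_mxE _ _ _ dT).
by congr ('D_v _ x); apply/funext => y; rewrite mxE.
Qed.

Section ChernForm.
Context {R : realType} {V : normedModType R} {m : nat}.
Variables (U : set V) (oU : open U) (I : 'M[R]_m) (N : V -> 'M[R]_m).
Hypotheses (sN : smooth_on U N) (NN : forall x, U x -> N x *m N x = N x)
  (IN : forall x, U x -> I *m N x = N x *m I)
  (NT : forall x, U x -> (N x)^T = N x)
  (IT : I^T = - I).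

(** Up to a constant, the first Chern form of the bundle of images of [N]. *)
Definition chern_form (u v : V) (x : V) : R :=
  \tr (I *m N x *m 'D_u N x *m 'D_v N x).

Let dN x : U x -> differentiable N x := smooth_on_differentiable sN.

Lemma derive_projection_sym (u x : V) : U x -> ('D_u N x)^T = 'D_u N x.
Proof.
move=> Ux; apply/matrixP => i j; rewrite mxE !(derive_mxE _ _ _ (dN Ux)).
apply: near_eq_derive; apply: (open_near_eq oU) => // y Uy.
by rewrite -{1}(NT Uy) mxE.
Qed.

Lemma derive_projection_variation (u x : V) : U x -> proj_variation (N x) ('D_u N x).
Proof.
move=> Ux; rewrite /proj_variation -derive_mulmx; [|exact: dN|exact: dN].
by apply: near_eq_derive; apply: (open_near_eq oU) => // y Uy; rewrite NN.
Qed.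

Lemma chern_form_alternating u v x : U x -> chern_form u v x = - chern_form v u x.
Proof.
move=> Ux; exact: (trace_form_skew (IN Ux) (NT Ux) IT
  (derive_projection_sym u Ux) (derive_projection_sym v Ux)).
Qed.

Lemma smooth_chern_form u v : smooth_on U (chern_form u v).
Proof.
apply: smooth_on_sum => // i _.
have sm : smooth_on U (fun x => I *m N x *m 'D_u N x *m 'D_v N x).
  do 2 (apply: smooth_on_mulmx => //; last exact: smooth_on_derive).
  by apply: smooth_on_mulmx => //; exact: smooth_on_mxcst.
by move/(smooth_on_mxP oU): sm; exact.
Qed.

Lemma derive_chern_form (k u v x : V) : U x ->
  'D_k (chern_form u v) x = \tr (I *m N x *m 'D_k ('D_u N) x *m 'D_v N x)
    - \tr (I *m N x *m 'D_k ('D_v N) x *m 'D_u N x).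
Proof.
move=> Ux.
have d1 := dN Ux; have d2 w := smooth_on_differentiable (smooth_on_derive w sN) Ux.
have sIN : smooth_on U (fun y => I *m N y).
  by apply: smooth_on_mulmx => //; exact: smooth_on_mxcst.
have sINN w : smooth_on U (fun y => I *m N y *m 'D_w N y).
  by apply: smooth_on_mulmx => //; exact: smooth_on_derive.
have sF : smooth_on U (fun y => I *m N y *m 'D_u N y *m 'D_v N y).
  by apply: smooth_on_mulmx => //; exact: smooth_on_derive.
have dF := smooth_on_differentiable sF Ux.
have -> : 'D_k (chern_form u v) x =
    \tr ('D_k (fun y => I *m N y *m 'D_u N y *m 'D_v N y) x).
  rewrite (_ : chern_form u v = \sum_i (fun y => (I *m N y *m 'D_u N y *m 'D_v N y) i i)).
    rewrite derive_sum => [|i]; last first.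
      by apply: diff_derivable; move/differentiable_mxP: dF; exact.
    by apply: eq_bigr => i _; rewrite (derive_mxE _ _ _ dF).
  by apply/funext => y; rewrite fct_sumE.
rewrite (derive_mulmx _ (smooth_on_differentiable (sINN u) Ux) (d2 v)).
rewrite (derive_mulmx _ (smooth_on_differentiable sIN Ux) (d2 u)).
rewrite (derive_mulmx _ (differentiable_cst _ _) d1) derive_cst mul0mx add0r.
rewrite mulmxDl !mxtraceD.
have H0 : \tr (I *m 'D_k N x *m 'D_u N x *m 'D_v N x) = 0.
  rewrite -!mulmxA !(mulmxA ('D_k N x)).
  by apply: (trace_variation3 (NN Ux) (IN Ux)); exact: derive_projection_variation.
have DT : ('D_k ('D_v N) x)^T = 'D_k ('D_v N) x.
  apply: (etrans (derive_trmx k (d2 v))); apply: near_eq_derive.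
  by apply: (open_near_eq oU) => // y Uy; exact: derive_projection_sym.
have H2 := trace_form_skew (IN Ux) (NT Ux) IT (derive_projection_sym u Ux) DT.
by apply: (etrans (congr2 +%R (congr2 +%R H0 erefl) H2)); rewrite add0r.
Qed.

(** The form is closed: third-order terms are traces of three off-diagonal
    variations, and second derivatives cancel by symmetry. *)
Lemma chern_form_closed (a b c x : V) : U x ->
  'D_a (chern_form b c) x + 'D_b (chern_form c a) x + 'D_c (chern_form a b) x = 0.
Proof.
move=> Ux.
have [S [ST SS]] : exists S : V -> V -> V -> R,
    (forall k u v, 'D_k (chern_form u v) x = S k u v - S k v u) /\
    (forall k u v, S k u v = S u k v).
  exists (fun k u v => \tr (I *m N x *m 'D_k ('D_u N) x *m 'D_v N x)); split.
    by move=> k u v; exact: derive_chern_form.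
  move=> k u v.
  exact: (congr1 (fun X => \tr (I *m N x *m X *m 'D_v N x)) (schwarz_mx u k oU sN Ux)).
apply: (etrans (congr2 +%R (congr2 +%R (ST a b c) (ST b c a)) (ST c a b))).
rewrite (SS a b c) (SS b c a) (SS c a b); ring.
Qed.

End ChernForm.

(** * A divergence-free field built from a closed 2-form on R^6 *)

Section Symplectic.
Context {R : realType}.
Local Notation E6 := 'rV[R]_6.
Local Notation E7 := 'rV[R]_7.

Definition axis (a : nat) : E6 := delta_mx 0 (inord a).

Variable w : nat -> nat -> E6 -> R.
Definition form_at (x : E6) : nat -> nat -> R := fun a b => w a b x.
Definition cofactor_at (k j : nat) (x : E6) : R := pf_cofactor (form_at x) (form_at x) k j.

Hypotheses (sw : forall a b, smooth_on (setT : set E6) (w a b))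
  (wA : forall x, alternating_form (form_at x))
  (wC : forall a b c x, 'D_(axis a) (w b c) x + 'D_(axis b) (w c a) x + 'D_(axis c) (w a b) x = 0).

Let dw a b x v : derivable (w a b) x v.
Proof. exact: diff_derivable (smooth_on_differentiable (sw a b) I). Qed.

Lemma smooth_cofactor_at k j : smooth_on (setT : set E6) (cofactor_at k j).
Proof.
rewrite /cofactor_at /pf_cofactor; case: eqP => _; first exact: smooth_on_cst.
have s4 a b c d : smooth_on (setT : set E6) (fun x => pf4 (form_at x) (form_at x) a b c d).
  have oT : open (setT : set E6) := openT.
  have sM p q p' q' : smooth_on (setT : set E6) (fun x => form_at x p q * form_at x p' q').
    by apply: smooth_onM => //; exact: sw.
  have s3 : smooth_on (setT : set E6) (fun x => form_at x a b * form_at x c d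
      - form_at x a c * form_at x b d + form_at x a d * form_at x b c).
    by apply: smooth_onD => //; apply: smooth_onD => //; exact: smooth_onN.
  exact: smooth_onD.
by case: odd => //; apply: smooth_onN; first exact: openT.
Qed.

Lemma is_derive_pf4 a b c d v x :
  is_derive x v (fun x => pf4 (form_at x) (form_at x) a b c d)
    (2 * pf4 (form_at x) (fun a b => 'D_v (w a b) x) a b c d).
Proof.
have H p q p' q' : is_derive x v (w p q * w p' q')
    (w p q x * 'D_v (w p' q') x + w p' q' x * 'D_v (w p q) x).
  by split; [exact: derivableM|rewrite deriveM].
have H3 := is_deriveD (is_deriveB (H a b c d) (H a c b d)) (H a d b c).
by apply: is_derive_eq (is_deriveD H3 H3) _; rewrite /pf4 /form_at; ring.
Qed.

Lemma derive_cofactor_at k j v x :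
  'D_v (cofactor_at k j) x = 2 * pf_cofactor (form_at x) (fun a b => 'D_v (w a b) x) k j.
Proof.
rewrite /cofactor_at /pf_cofactor; case: eqP => _; first by rewrite derive_cst mulr0.
have D a b c d := is_derive_pf4 a b c d v x.
case: odd; last exact: (@derive_val _ _ _ _ _ _ _ (D _ _ _ _)).
rewrite mulrN; exact: (@derive_val _ _ _ _ _ _ _ (is_deriveN (D _ _ _ _))).
Qed.

Lemma derive_form_opp v a b x : 'D_v (w a b) x = - 'D_v (w b a) x.
Proof.
have -> : w a b = - w b a by apply/funext => y; exact: wA.
by apply: deriveN; exact: dw.
Qed.

Lemma cofactor_at_closed j x : (j < 6)%N ->
  \sum_(k < 6) 'D_(axis k) (cofactor_at k j) x = 0.
Proof.
move=> j6; pose W k a b := 'D_(axis k) (w a b) x.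
have WA k : alternating_form (W k) by move=> a b; exact: derive_form_opp.
have WC a b c : W a b c + W b c a + W c a b = 0 by exact: wC.
rewrite (eq_bigr (fun k : 'I_6 => 2 * pf_cofactor (form_at x) (W k) k j)) => [|k _].
  by rewrite -mulr_sumr (pf_cofactor_closed _ j6 WA WC) mulr0.
exact: derive_cofactor_at.
Qed.

(** The coordinate 0 of R^7 is a time t, the others form a point x of R^6. *)
Definition spatial (y : E7) : E6 := \row_i y 0 (lift ord0 i).
Definition shifted (y : E7) : E6 := spatial y + y 0 0 *: axis 0.

Lemma spatial_linear (h : R) v y : spatial (h *: v + y) = h *: spatial v + spatial y.
Proof. by apply/rowP => i; rewrite !mxE. Qed.

Lemma shifted_linear (h : R) v y : shifted (h *: v + y) = h *: shifted v + shifted y.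
Proof.
by rewrite /shifted spatial_linear !mxE scalerDr addrACA scalerDl scalerA.
Qed.

Lemma spatial_e0 : spatial (delta_mx 0 0) = 0.
Proof. by apply/rowP => i; rewrite !mxE. Qed.

Lemma spatial_e k : spatial (delta_mx 0 (lift ord0 k)) = axis k.
Proof. by apply/rowP => i; rewrite !mxE (inj_eq lift_inj) inord_val. Qed.

Lemma shifted_e0 : shifted (delta_mx 0 0) = axis 0.
Proof. by rewrite /shifted spatial_e0 add0r mxE !eqxx scale1r. Qed.

Lemma shifted_e k : shifted (delta_mx 0 (lift ord0 k)) = axis k.
Proof. by rewrite /shifted spatial_e mxE /= scale0r addr0. Qed.

Lemma smooth_linear (L : E7 -> E6) (f : E6 -> R) :
  (forall (h : R) v y, L (h *: v + y) = h *: L v + L y) ->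
  smooth_on (setT : set E6) f -> smooth_on (setT : set E7) (f \o L).
Proof.
move=> HL sf; apply: (smooth_on_comp openT sf) => // i.
have L0 : L 0 = 0 by have := HL (-1) 0 0; rewrite scaler0 addr0 scaleN1r addrC subrr.
have -> : (fun y : E7 => L y 0 i) = fun y => \sum_k y 0 k * L (delta_mx 0 k) 0 i.
  apply/funext => y; rewrite {1}(row_sum_delta y).
  elim/big_rec2: _ => [|k s t _ IH]; first by rewrite L0 mxE.
  by rewrite HL !mxE IH.
apply: smooth_on_sum => [|k _]; first exact: openT.
apply: smooth_onM => //; first exact: openT.
  by apply: smooth_on_coord; exact: openT.
exact: smooth_on_cst.
Qed.

(** The vector field dual to the closed 6-form shift^* w /\ w /\ w, where the
    first factor is pulled back by (t, x) |-> x + t e_0 and the others by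
    (t, x) |-> x. *)
Definition flux (k : 'I_7) : E7 -> R :=
  if unlift ord0 k is Some k' then
    \sum_(j < 6) (cst (-2) * ((w 0 j \o shifted) * (cofactor_at k' j \o spatial)))
  else \sum_(k < 6) \sum_(j < 6) ((w k j \o shifted) * (cofactor_at k j \o spatial)).

Lemma smooth_flux k : smooth_on (setT : set E7) (flux k).
Proof.
have oT : open (setT : set E7) := openT.
have s1 a b := smooth_linear shifted_linear (sw a b).
have s2 a b := smooth_linear spatial_linear (smooth_cofactor_at a b).
rewrite /flux; case: unlift => [k'|].
  rewrite fct_sumE; apply: smooth_on_sum => // j _; apply: smooth_onM => //.
    exact: smooth_on_cst.
  exact: smooth_onM.
rewrite fct_sumE; apply: smooth_on_sum => // i _; rewrite fct_sumE.
by apply: smooth_on_sum => // j _; exact: smooth_onM.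
Qed.

(** Closedness enters twice: the time derivative of the translated form is the
    differential of its contraction with e_0, and w /\ w is closed. *)
Lemma flux_divergence y : \sum_k 'D_(delta_mx 0 k) (flux k) y = 0.
Proof.
have d1 a b v : derivable (w a b \o shifted) y v.
  exact: diff_derivable (smooth_on_differentiable (smooth_linear shifted_linear (sw a b)) I).
have d2 a b v : derivable (cofactor_at a b \o spatial) y v.
  exact: diff_derivable (smooth_on_differentiable (smooth_linear spatial_linear (smooth_cofactor_at a b)) I).
have D1 a b v : 'D_v (w a b \o shifted) y = 'D_(shifted v) (w a b) (shifted y).
  by apply: derive_affine => h z; exact: shifted_linear.
have D2 a b v : 'D_v (cofactor_at a b \o spatial) y = 'D_(spatial v) (cofactor_at a b) (spatial y).
  by apply: derive_affine => h z; exact: spatial_linear.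
pose W a b c := 'D_(axis a) (w b c) (shifted y).
pose c k j := cofactor_at k j (spatial y).
have F0 : 'D_(delta_mx 0 0) (flux 0) y = \sum_(k < 6) \sum_(j < 6) W 0%N k j * c k j.
  rewrite /flux unlift_none derive_sum => [|k]; last first.
    by apply: derivable_sum => j; exact: derivableM.
  apply: eq_bigr => k _; rewrite derive_sum => [|j]; last exact: derivableM.
  apply: eq_bigr => j _; rewrite (deriveM (d1 _ _ _) (d2 _ _ _)).
  rewrite D1 D2 shifted_e0 spatial_e0 derive0 scaler0 add0r.
  exact: mulrC.
have F1 (k : 'I_6) : 'D_(delta_mx 0 (lift ord0 k)) (flux (lift ord0 k)) y =
    -2 * \sum_(j < 6) (W k 0%N j * c k j + w 0 j (shifted y) * 'D_(axis k) (cofactor_at k j) (spatial y)).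
  rewrite /flux liftK derive_sum => [|j]; last by apply: derivableM => //; exact: derivableM.
  rewrite mulr_sumr; apply: eq_bigr => j _.
  rewrite (deriveM (derivable_cst _ _ _) (derivableM (d1 _ _ _) (d2 _ _ _))) derive_cst scaler0 addr0.
  rewrite (deriveM (d1 _ _ _) (d2 _ _ _)) D1 D2 shifted_e spatial_e.
  by congr (_ * _); rewrite addrC; congr (_ + _); exact: mulrC.
rewrite big_ord_recl F0 (eq_bigr _ (fun k _ => F1 k)) -mulr_sumr.
have -> : \sum_(k < 6) \sum_(j < 6) (W k 0%N j * c k j + w 0 j (shifted y) * 'D_(axis k) (cofactor_at k j) (spatial y))
  = \sum_(k < 6) \sum_(j < 6) W k 0%N j * c k j.
  rewrite (eq_bigr _ (fun k _ => big_split _ _ _ _ _)) big_split /= [X in _ + X]exchange_big /=.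
  rewrite [X in _ + X]big1 ?addr0 // => j _.
  by rewrite -mulr_sumr cofactor_at_closed // mulr0.
have WE (k j : 'I_6) : W 0%N k j = W k 0%N j - W j 0%N k.
  have WA : W k j 0%N = - W k 0%N j.
    exact: derive_form_opp.
  have := wC 0 k j (shifted y); rewrite -/(W 0%N k j) -/(W k j 0%N) -/(W j 0%N k) WA; lra.
rewrite (eq_bigr (fun k : 'I_6 => \sum_(j < 6) W k 0%N j * c k j - \sum_(j < 6) W j 0%N k * c k j)); last first.
  by move=> k _; rewrite -sumrB; apply: eq_bigr => j _; rewrite WE mulrBl.
rewrite sumrB [X in _ - X + _]exchange_big /=.
rewrite [X in _ - X + _](eq_bigr (fun j : 'I_6 => - \sum_(k < 6) W j 0%N k * c j k)).
  by rewrite sumrN; ring.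
by move=> j _; rewrite -sumrN; apply: eq_bigr => k _; rewrite /c /cofactor_at pf_cofactorC mulrN.
Qed.

End Symplectic.

(** * No decaying symplectic form on R^6 *)

Lemma nonvanishing_sign (R : realType) n (f : 'rV[R]_n -> R) :
  continuous f -> (forall x, f x != 0) -> exists2 s, `|s| = 1 & forall x, 0 < s * f x.
Proof.
move=> cf f0; exists (Num.sg (f 0)); first by rewrite normr_sg f0.
move=> x; rewrite lt0r mulf_neq0 ?sgr_eq0 //=; apply: contrapT => /negP; rewrite -ltNge => neg.
have cg : {within `[0 : R, 1], continuous (fun t : R => f (t *: x))}.
  apply: continuous_subspaceT => t; apply: continuous_comp; last exact: cf.
  exact: scalel_continuous.
have : ~ (Num.min (f 0) (f x) <= 0 <= Num.max (f 0) (f x)).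
  have := @IVT R _ 0 1 0 ler01 cg; rewrite scale0r scale1r => H /H[c _ /eqP].
  by rewrite (negPf (f0 _)).
apply; rewrite ge_min le_max; case: (ltgtP (f 0) 0) => h.
- by rewrite (ltr0_sg h) mulN1r oppr_lt0 in neg; rewrite (ltW neg) orbT.
- by rewrite (gtr0_sg h) mul1r in neg; rewrite (ltW neg).
- by have := f0 0; rewrite h eqxx.
Qed.

Lemma pf_cofactor_bound (R : realType) (v : nat -> nat -> R) (B : R) k j :
  (forall a b, `|v a b| <= B) -> `|pf_cofactor v v k j| <= 6 * B ^+ 2.
Proof.
move=> vB; have B0 : 0 <= B by rewrite (le_trans _ (vB 0 0)%N).
have H a b c d : `|v a b * v c d| <= B ^+ 2 by rewrite normrM expr2 ler_pM.
have P a b c d : `|pf4 v v a b c d| <= 6 * B ^+ 2.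
  rewrite /pf4; move: (H a b c d) (H a c b d) (H a d b c).
  by rewrite !ler_norml => /andP[? ?] /andP[? ?] /andP[? ?]; apply/andP; split; lra.
rewrite /pf_cofactor; case: eqP => _; first by rewrite normr0 mulr_ge0 // sqr_ge0.
by case: odd; rewrite ?normrN; exact: P.
Qed.

(** Along each axis the points of the unit interval are the window
    r m <= j < r m + m of the grid with 2 r m points on [-r, r]. *)
Lemma window_count (R : realType) (r m : nat) : (1 <= r)%N ->
  m%:R <= \sum_(j < 2 * r * m) ((r * m <= j < r * m + m)%N)%:R :> R.
Proof.
move=> r1; rewrite -(big_mkord xpredT (fun j => ((r * m <= j < r * m + m)%N)%:R : R)).
have h : (r * m + m <= 2 * r * m)%N by rewrite mul2n -addnn mulnDl leq_add2l leq_pmull.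
rewrite (big_cat_nat (n := r * m)) ?(leq_trans (leq_addr m _) h) //=.
rewrite (big_cat_nat (m := r * m) (n := r * m + m)) ?leq_addr //=.
have -> : \sum_(r * m <= j < r * m + m) (r * m <= j < r * m + m)%N%:R = m%:R :> R.
  by rewrite (eq_big_nat _ _ (F2 := fun=> 1)) => [|j ->//]; rewrite sumr_const_nat addKn.
by rewrite addrCA lerDl addr_ge0 // sumr_ge0.
Qed.

Section NoSymplectic.
Context {R : realType}.
Local Notation E6 := 'rV[R]_6.
Local Notation E7 := 'rV[R]_7.

Variable w : nat -> nat -> E6 -> R.
Hypotheses (sw : forall a b, smooth_on (setT : set E6) (w a b))
  (wA : forall x, alternating_form (form_at w x))
  (wC : forall a b c x, 'D_(axis a) (w b c) x + 'D_(axis b) (w c a) x + 'D_(axis c) (w a b) x = 0)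
  (nd : forall x (u : nat -> R), (forall j, (j < 6)%N -> \sum_(i < 6) u i * form_at w x i j = 0) ->
     forall i, (i < 6)%N -> u i = 0).
Variable C : R.
Hypotheses (wb : forall a b x, `|w a b x| <= C)
  (wd : forall a b (x : E6) k (r : R), 1 <= r -> r <= `|x 0 k| -> `|w a b x| <= C / r ^+ 4).

Let C0 : 0 <= C. Proof. exact: le_trans (normr_ge0 _) (wb 0 0 0). Qed.

Section Estimate.
Variables (r : nat) (r2 : (2 <= r)%N).
Let rR : 2 <= r%:R :> R. Proof. by rewrite ler_nat. Qed.
Let r0 : 0 < r%:R :> R. Proof. by rewrite ltr0n (leq_trans _ r2). Qed.

(** The slab [0, r^2] x [-r, r]^6.  The duration r^2 is long enough for the
    translated form to be O(r^-8) on the slab at the end, and short enough for the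
    lateral flux to be negligible. *)
Definition slab_corner (i : 'I_7) : R := if unlift ord0 i is Some _ then - r%:R else 0.
Definition slab_size (i : 'I_7) : R := if unlift ord0 i is Some _ then 2 * r%:R else r%:R ^+ 2.

Lemma slab_size_gt0 i : 0 < slab_size i.
Proof. by rewrite /slab_size; case: unlift => [_|]; rewrite ?mulr_gt0 ?exprn_gt0. Qed.

Local Notation gp := (grid_point slab_corner slab_size).

Lemma gp_spatial N f i : spatial (gp N f) 0 i = - r%:R + 2 * r%:R * ((f (lift ord0 i))%:R / N%:R).
Proof. by rewrite !mxE /slab_corner /slab_size liftK. Qed.

Lemma gp_time N f : gp N f 0 0 = r%:R ^+ 2 * ((f ord0)%:R / N%:R).
Proof. by rewrite !mxE /slab_corner /slab_size unlift_none add0r. Qed.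

Lemma flux_start N f : (0 < N)%N ->
  flux w 0 (gp N (upd f 0 0)) = pfaffian (form_at w (spatial (gp N (upd f 0 0)))).
Proof.
move=> N0; set y := gp _ _; have E : shifted y = spatial y.
  by rewrite /shifted gp_time /upd eqxx mul0r mulr0 scale0r addr0.
rewrite /flux unlift_none fct_sumE; apply: eq_bigr => k _.
rewrite fct_sumE; apply: eq_bigr => j _.
by rewrite -[LHS]/(w k j (shifted y) * cofactor_at w k j (spatial y)) E.
Qed.

(** At time r^2 the translated point has first coordinate at least
    r^2 - r >= r^2 / 2. *)
Lemma flux_end N (f : {ffun 'I_7 -> 'I_N}) : (0 < N)%N ->
  `|flux w 0 (gp N (upd (fun i => f i) 0 N))| <= (36 * 96) * C ^+ 3 / r%:R ^+ 8.
Proof.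
move=> N0; have N0' : 0 < N%:R :> R by rewrite ltr0n.
rewrite /flux unlift_none; set y := gp _ _.
have f1 a b : `|w a b (shifted y)| <= 16 * C / r%:R ^+ 8.
  have x0 : - r%:R <= spatial y 0 0.
    by rewrite gp_spatial lerDl mulr_ge0 ?mulr_ge0 ?divr_ge0 // ltW.
  have -> : 16 * C / r%:R ^+ 8 = C / (r%:R ^+ 2 / 2) ^+ 4 by field; rewrite gt_eqF.
  apply: (@wd _ _ _ 0).
    by rewrite ler_pdivlMr // mul1r expr2; have := rR; nra.
  have yT : y 0 0 = r%:R ^+ 2 by rewrite gp_time /upd eqxx divff ?mulr1 // gt_eqF.
  have -> : shifted y 0 0 = spatial y 0 0 + r%:R ^+ 2.
    have a0 : axis 0 0 0 = 1 :> R.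
      by rewrite mxE eqxx (_ : (0 == inord 0)) // -val_eqE /= inordK.
    by rewrite [LHS]mxE [X in _ + X]mxE yT a0 mulr1.
  have hr : r%:R <= r%:R ^+ 2 / 2 :> R by rewrite expr2; have := rR; nra.
  have h1 : r%:R ^+ 2 / 2 <= spatial y 0 0 + r%:R ^+ 2 by lra.
  by rewrite ger0_norm // (le_trans _ h1) // (le_trans _ hr) // ltW.
have f2 k j : `|cofactor_at w k j (spatial y)| <= 6 * C ^+ 2 by apply: pf_cofactor_bound => a b; exact: wb.
rewrite fct_sumE; apply: le_trans (ler_norm_sum _ _ _) _.
apply: (@le_trans _ _ (\sum_(k < 6) \sum_(j < 6) (16 * C / r%:R ^+ 8) * (6 * C ^+ 2))).
  apply: ler_sum => k _; rewrite fct_sumE; apply: le_trans (ler_norm_sum _ _ _) _.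
  apply: ler_sum => j _.
  by rewrite -[X in `|X|]/(w k j (shifted y) * cofactor_at w k j (spatial y)) normrM ler_pM.
rewrite !sumr_const !card_ord -mulrnA -[leLHS]mulr_natr le_eqVlt; apply/orP; left; apply/eqP.
by field; rewrite gt_eqF.
Qed.

(** On a lateral face both factors of w /\ w are O(r^-4). *)
Lemma flux_side N (f : 'I_7 -> nat) (k : 'I_6) : (0 < N)%N ->
  `|spatial (gp N f) 0 k| = r%:R ->
  `|flux w (lift ord0 k) (gp N f)| <= 72 * C ^+ 3 / r%:R ^+ 8.
Proof.
move=> N0 yk; rewrite /flux liftK; set y := gp _ _ in yk *.
have f2 j : `|cofactor_at w k j (spatial y)| <= 6 * (C / r%:R ^+ 4) ^+ 2.
  by apply: pf_cofactor_bound => a b; apply: (wd _ _ (k := k)); [have := rR; lra|rewrite yk].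
rewrite fct_sumE; apply: le_trans (ler_norm_sum _ _ _) _.
apply: (@le_trans _ _ (\sum_(j < 6) 2 * (C * (6 * (C / r%:R ^+ 4) ^+ 2)))).
  apply: ler_sum => j _.
  rewrite -[X in `|X|]/(-2 * (w 0 j (shifted y) * cofactor_at w k j (spatial y))).
  rewrite !normrM normrN (ger0_norm (ler0n _ _)).
  by rewrite ler_pM2l // ler_pM //; exact: wb.
rewrite sumr_const card_ord -[leLHS]mulr_natr le_eqVlt; apply/orP; left; apply/eqP.
by field; rewrite gt_eqF.
Qed.

(** The Pfaffian has constant sign, so the grid points of the unit cube already
    give a lower bound. *)
Lemma flux_start_sum (s eps : R) m : (0 < m)%N -> 0 < eps ->
  (forall x, 0 < s * pfaffian (form_at w x)) ->
  (forall x, box (fun=> 0) (fun=> 1) x -> eps <= s * pfaffian (form_at w x)) ->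
  eps * ((2 * r * m) * m ^ 6)%:R <= \sum_(f : {ffun 'I_7 -> 'I_(2 * r * m)})
     s * flux w 0 (gp (2 * r * m) (upd (fun i => f i) 0 0)).
Proof.
move=> m0 e0 pos low; set N := (2 * r * m)%N.
have N0 : (0 < N)%N by rewrite !muln_gt0 m0 (leq_trans _ r2).
(* The indicator of the grid points over the unit cube, as a product over the
   coordinates, so that its sum factors. *)
pose g (i : 'I_7) (j : 'I_N) : R :=
  if unlift ord0 i is Some _ then (r * m <= j < r * m + m)%N%:R else 1.
apply: (@le_trans _ _ (eps * \prod_i \sum_j g i j)).
  rewrite ler_pM2l // big_ord_recl [X in _ <= X * _](eq_bigr (fun=> 1)) => [|j _]; last first.
    by rewrite /g unlift_none.
  rewrite sumr_const card_ord natrM ler_wpM2l // natrX -[X in _ ^+ X]card_ord -prodr_const.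
  apply: ler_prod => i _; rewrite ler0n /=.
  rewrite (eq_bigr (fun j : 'I_N => (r * m <= j < r * m + m)%N%:R)); last first.
    by move=> j _; rewrite /g liftK.
  by apply: window_count; exact: leq_trans r2.
rewrite bigA_distr_bigA mulr_sumr; apply: ler_sum => f _.
rewrite flux_start //; set x := spatial _.
have [inw|/forallPn[i ni]] := boolP [forall i : 'I_6, (r * m <= f (lift ord0 i) < r * m + m)%N]; last first.
  rewrite (bigD1 (lift ord0 i)) //= /g liftK (negPf ni) mul0r mulr0.
  exact/ltW/pos.
rewrite big1 => [|i _]; last first.
  by rewrite /g; case: unliftP => // i' ->; move/forallP: inw => ->.
rewrite mulr1; apply: low => i /=; rewrite add0r gp_spatial /upd /=.
move/forallP: inw => /(_ i) /andP[]; set q := nat_of_ord _.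
rewrite -(ler_nat R) -(ltr_nat R) natrD natrM => h1 h2.
have m0' : 0 < m%:R :> R by rewrite ltr0n.
have -> : - r%:R + 2 * r%:R * (q%:R / N%:R) = (q%:R - r%:R * m%:R) / m%:R :> R.
  by rewrite /N !natrM; field; rewrite !gt_eqF.
by rewrite divr_ge0 ?subr_ge0 // ler_pdivrMr // mul1r; lra.
Qed.

(** Dividing by the number N m^6 of grid points of the slab over the unit cube,
    the start face gives eps / r^2, the end face O(r^-4), the sides O(r^-3) and
    the discretization error a quantity that tends to 0 with 1/m. *)
Lemma main_estimate (s eps : R) : 0 < eps -> `|s| = 1 ->
  (forall x, 0 < s * pfaffian (form_at w x)) ->
  (forall x, box (fun=> 0) (fun=> 1) x -> eps <= s * pfaffian (form_at w x)) ->
  exists D, forall m, (0 < m)%N -> eps <= (64 * (36 * 96 + 6 * 72)) * C ^+ 3 / r%:R + D / m%:R.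
Proof.
move=> e0 s1 pos low.
have [D0 D00 HD] := discrete_divergence slab_corner slab_size_gt0 (smooth_flux sw)
  (flux_divergence sw wA wC).
exists (32 * r%:R ^+ 7 * D0) => m m0.
have m0' : 0 < m%:R :> R by rewrite ltr0n.
pose N := (2 * r * m)%N.
have N0 : (0 < N)%N by rewrite !muln_gt0 m0 (leq_trans _ r2).
have N0' : 0 < N%:R :> R by rewrite ltr0n.
have NE : N%:R = 2 * r%:R * m%:R :> R by rewrite /N !natrM.
pose T k := \sum_(f : {ffun 'I_7 -> 'I_N}) flux w k (gp N (upd (fun i => f i) k N)).
pose B k := \sum_(f : {ffun 'I_7 -> 'I_N}) flux w k (gp N (upd (fun i => f i) k 0)).
have {HD} := HD N N0.
rewrite (eq_bigr (fun k => (slab_size k)^-1 * (T k - B k))); last by move=> k _; rewrite -sumrB.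
rewrite big_ord_recl /= [slab_size ord0]/slab_size unlift_none.
set side := \sum_(k < 6) _ => HD.
have cardN : #|{: {ffun 'I_7 -> 'I_N}}| = (N ^ 7)%N by rewrite card_ffun !card_ord.
pose c8 : R := C ^+ 3 / r%:R ^+ 8.
have sumle (F : {ffun 'I_7 -> 'I_N} -> R) (b : R) : (forall f, `|F f| <= b) ->
    `|\sum_f F f| <= b * (N ^ 7)%:R.
  move=> Fb; apply: le_trans (ler_norm_sum _ _ _) _.
  apply: le_trans (ler_sum _ (fun f _ => Fb f)) _.
  by rewrite sumr_const cardN mulr_natr.
have Tb : `|T ord0| <= (36 * 96) * c8 * (N ^ 7)%:R.
  by apply: sumle => f; rewrite /c8 mulrA; exact: flux_end.
have sideb : `|side| <= (6 * 72) * c8 / r%:R * (N ^ 7)%:R.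
  apply: le_trans (ler_norm_sum _ _ _) _.
  apply: (@le_trans _ _ (\sum_(k < 6) (2 * r%:R)^-1 * ((2 * 72) * c8 * (N ^ 7)%:R))).
    apply: ler_sum => k _; rewrite /slab_size liftK normrM.
    rewrite (ger0_norm (x := (2 * r%:R)^-1)); last by rewrite invr_ge0 mulr_ge0 // ltW.
    apply: ler_wpM2l; first by rewrite invr_ge0 mulr_ge0 // ltW.
    have -> : (2 * 72) * c8 * (N ^ 7)%:R = 72 * c8 * (N ^ 7)%:R + 72 * c8 * (N ^ 7)%:R :> R by ring.
    apply: le_trans (ler_normB _ _) _; apply: lerD; apply: sumle => f;
    rewrite /c8 mulrA; apply: flux_side => //; rewrite gp_spatial /upd eqxx.
      rewrite divff ?mulr1 ?gt_eqF //; rewrite ger0_norm; have := rR; lra.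
    by rewrite mul0r mulr0 addr0 normrN ger0_norm // ltW.
  rewrite sumr_const card_ord -[leLHS]mulr_natr le_eqVlt; apply/orP; left; apply/eqP.
  by field; rewrite gt_eqF.
have Bb := flux_start_sum m0 e0 pos low.
rewrite -mulr_sumr -/N -/(B ord0) in Bb.
have s_le (z b : R) : `|z| <= b -> s * z <= b.
  by move=> zb; apply: le_trans (ler_norm _) _; rewrite normrM s1 mul1r.
have key : (r%:R ^+ 2)^-1 * (s * B ord0) <= (r%:R ^+ 2)^-1 * ((36 * 96) * c8 * (N ^ 7)%:R)
    + (6 * 72) * c8 / r%:R * (N ^ 7)%:R + D0 / N%:R * (N ^ 7)%:R.
  have -> : (r%:R ^+ 2)^-1 * (s * B ord0) = (r%:R ^+ 2)^-1 * (s * T ord0) + s * side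
     + s * - ((r%:R ^+ 2)^-1 * (T ord0 - B ord0) + side) by ring.
  apply: lerD; last by apply: s_le; rewrite normrN.
  apply: lerD; last exact: s_le.
  by apply: ler_wpM2l; [rewrite invr_ge0 exprn_ge0 // ltW|exact: s_le].
have key2 : (r%:R ^+ 2)^-1 * (eps * (N * m ^ 6)%:R) <= 
    ((36 * 96) * c8 / r%:R ^+ 2 + (6 * 72) * c8 / r%:R + D0 / N%:R) * (N ^ 7)%:R.
  have -> : ((36 * 96) * c8 / r%:R ^+ 2 + (6 * 72) * c8 / r%:R + D0 / N%:R) * (N ^ 7)%:R =
     (r%:R ^+ 2)^-1 * ((36 * 96) * c8 * (N ^ 7)%:R)
    + (6 * 72) * c8 / r%:R * (N ^ 7)%:R + D0 / N%:R * (N ^ 7)%:R by ring.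
  apply: le_trans key; apply: ler_wpM2l; first by rewrite invr_ge0 exprn_ge0 // ltW.
  exact: Bb.
have E1 : (r%:R ^+ 2)^-1 * (eps * (N * m ^ 6)%:R) = (N%:R * m%:R ^+ 6 / r%:R ^+ 2) * eps :> R.
  by rewrite natrM natrX; ring.
have E2 : ((36 * 96) * c8 / r%:R ^+ 2 + (6 * 72) * c8 / r%:R + D0 / N%:R) * (N ^ 7)%:R
  = (N%:R * m%:R ^+ 6 / r%:R ^+ 2) * (64 * C ^+ 3 * ((36 * 96) / r%:R ^+ 2 + (6 * 72) / r%:R) + 
       32 * r%:R ^+ 7 * D0 / m%:R).
  by rewrite natrX NE /c8; field; rewrite !gt_eqF.
rewrite E1 E2 ler_pM2l in key2; last by rewrite divr_gt0 ?mulr_gt0 ?exprn_gt0.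
apply: le_trans key2 _; rewrite lerD2r.
have C3 : 0 <= C ^+ 3 by rewrite exprn_ge0.
have -> : 64 * C ^+ 3 * (36 * 96 / r%:R ^+ 2 + 6 * 72 / r%:R)
   = C ^+ 3 * (64 * (36 * 96 / r%:R ^+ 2 + 6 * 72 / r%:R)) by ring.
have -> : 64 * (36 * 96 + 6 * 72) * C ^+ 3 / r%:R
   = C ^+ 3 * (64 * (36 * 96 / r%:R + 6 * 72 / r%:R)) by ring.
rewrite ler_wpM2l //.
have ri : (36 * 96) / r%:R ^+ 2 <= (36 * 96) / r%:R :> R.
  rewrite ler_wpM2l // lef_pV2 ?posrE ?exprn_gt0 // expr2 ler_peMl ?ltW //; have := rR; lra.
have : 0 <= r%:R^-1 :> R by rewrite invr_ge0 ltW.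
by move: ri; lra.
Qed.

End Estimate.

(** A decay of order |x|^-4 is that of a smooth 2-form on S^6 in a stereographic
    chart, so this is the nonexistence of symplectic forms on S^6. *)
Theorem no_decaying_symplectic_form : False.
Proof.
have pf0 x : pfaffian (form_at w x) != 0.
  by apply: pfaffian_neq0; [exact: wA|exact: nd].
have cpf : continuous (fun x => pfaffian (form_at w x)).
  move=> x; apply: differentiable_continuous.
  apply: (@smooth_on_differentiable _ _ _ setT) => //.
  apply: smooth_on_sum => [|k _]; first exact: openT.
  apply: smooth_on_sum => [|j _]; first exact: openT.
  by apply: smooth_onM; [exact: openT|exact: sw|exact: (smooth_cofactor_at sw)].
have [s s1 pos] := nonvanishing_sign cpf pf0.
have [eps e0 low] : exists2 eps, 0 < eps &
    forall x : E6, box (fun=> 0) (fun=> 1) x -> eps <= s * pfaffian (form_at w x).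
  have [||c _ Hc] := @EVT_min_rV R 6 (fun x => s * pfaffian (form_at w x))
     (box (fun=> 0) (fun=> 1)) _ (@compact_box R 6 (fun=> 0) (fun=> 1)) _.
  - by exists 0 => i; rewrite mxE lexx /= add0r ler01.
  - apply: continuous_subspaceT => x; exact: (continuousM (@cst_continuous _ _ s x) (cpf x)).
  by exists (s * pfaffian (form_at w c)) => // x bx; apply: Hc; rewrite inE.
have e2 : 0 < eps / 2 by rewrite divr_gt0.
(* First r, then the mesh, because the discretization constant depends on r. *)
have [r r2 hr] : exists2 r, (2 <= r)%N & (64 * (36 * 96 + 6 * 72)) * C ^+ 3 / r%:R < eps / 2.
  have h0 : 0 <= 64 * (36 * 96 + 6 * 72) * C ^+ 3 / (eps / 2).
    by apply: divr_ge0; [apply: mulr_ge0 (exprn_ge0 _ C0)|exact: ltW].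
  exists (Num.bound ((64 * (36 * 96 + 6 * 72)) * C ^+ 3 / (eps / 2)) + 2)%N; first by rewrite leq_addl.
  rewrite ltr_pdivrMr ?ltr0n ?addn2 // [ltRHS]mulrC -ltr_pdivrMr //.
  apply: lt_le_trans (archi_boundP h0) _; by rewrite ler_nat; do 2 apply: leqW.
have [D HD] := main_estimate r2 e0 s1 pos low.
have h0 : 0 <= `|D| / (eps / 2) by apply: divr_ge0 (ltW e2).
have hm := archi_boundP h0; set m := Num.bound _ in hm.
have := HD m.+1 isT.
have : D / m.+1%:R < eps / 2.
  rewrite ltr_pdivrMr ?ltr0n // [ltRHS]mulrC -ltr_pdivrMr //.
  apply: le_lt_trans (lt_trans hm _); last by rewrite ltr_nat.
  by rewrite ler_pM2r ?invr_gt0 ?divr_gt0 // ler_norm.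
by move=> h1 h2; have := le_lt_trans h2 (ltrD hr h1); rewrite -splitr ltxx.
Qed.

End NoSymplectic.

(** * The stereographic chart *)

Section Stereographic.
Context {R : realType} {n : nat}.
Local Notation En := 'rV[R]_n.
Local Notation E := 'rV[R]_n.+1.

(** The conformal factor of the inverse stereographic projection: it measures the
    length in S^n of a unit vector of the chart. *)
Definition conformal (x : En) : R := 2 / (1 + dot x x).

(** Inverse stereographic projection from the first basis vector. *)
Definition stereo (x : En) : E :=
  \row_i (if unlift ord0 i is Some k then conformal x * x 0 k else 1 - conformal x).

Lemma den_gt0 (x : En) : 0 < 1 + dot x x.
Proof. by rewrite ltr_wpDr ?dot_ge0. Qed.

Lemma conformal_gt0 x : 0 < conformal x.
Proof. by rewrite divr_gt0 ?den_gt0. Qed.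

Lemma conformal_dot x : conformal x * dot x x = 2 - conformal x.
Proof. by have := den_gt0 x; rewrite /conformal => h; field; rewrite gt_eqF. Qed.

Lemma dot_recl (u v : E) : dot u v = u 0 0 * v 0 0 + \sum_k u 0 (lift ord0 k) * v 0 (lift ord0 k).
Proof. by rewrite /dot big_ord_recl. Qed.

Lemma stereo0 x : stereo x 0 0 = 1 - conformal x.
Proof. by rewrite mxE unlift_none. Qed.

Lemma stereoS x k : stereo x 0 (lift ord0 k) = conformal x * x 0 k.
Proof. by rewrite mxE liftK. Qed.

Lemma stereo_unit x : dot (stereo x) (stereo x) == 1.
Proof.
rewrite dot_recl stereo0 (eq_bigr (fun k => conformal x ^+ 2 * (x 0 k * x 0 k))); last first.
  by move=> k _; rewrite stereoS; ring.
rewrite -mulr_sumr -/(dot x x) expr2 -mulrA conformal_dot; apply/eqP; ring.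
Qed.

Definition chart (x : En) : sphere R n := exist _ (stereo x) (stereo_unit x).

Definition dstereo (x u : En) : E :=
  \row_i (if unlift ord0 i is Some k
          then conformal x * u 0 k - conformal x ^+ 2 * dot x u * x 0 k
          else conformal x ^+ 2 * dot x u).

Lemma smooth_conformal : smooth_on (setT : set En) conformal.
Proof.
have oT : open (setT : set En) := openT.
apply: smooth_onM => //; first exact: smooth_on_cst.
apply: smooth_onV => //; last by move=> x _; rewrite gt_eqF ?den_gt0.
apply: smooth_onD => //; first exact: smooth_on_cst.
by apply: smooth_on_dot => //; exact: smooth_on_id.
Qed.

Lemma smooth_stereo : smooth_on (setT : set En) stereo.
Proof.
have oT : open (setT : set En) := openT.
apply/smooth_on_mxP => // i j; rewrite ord1.
case: (unliftP ord0 j) => [k ->|->].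
  rewrite (_ : (fun _ => _) = fun x => conformal x * x 0 k).
    by apply: smooth_onM => //; [exact: smooth_conformal|exact: smooth_on_coord].
  by apply/funext => x; rewrite stereoS.
rewrite (_ : (fun _ => _) = fun x => 1 + - conformal x).
  apply: smooth_onD => //; first exact: smooth_on_cst.
  by apply: smooth_onN => //; exact: smooth_conformal.
by apply/funext => x; rewrite stereo0.
Qed.

Lemma derive_conformal x u : 'D_u conformal x = - (conformal x ^+ 2 * dot x u).
Proof.
have dq : differentiable (fun y : En => dot y y) x.
  apply: (@smooth_on_differentiable _ _ _ setT) => //.
  by apply: smooth_on_dot; [exact: openT|exact: smooth_on_id openT|exact: smooth_on_id openT].
have di : differentiable (@id En) x by exact: ex_diff.
have Eq : 'D_u (fun y : En => dot y y) x = 2 * dot x u.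
  by rewrite (derive_dot u di di) derive_id (dotC u); ring.
have h : (cst 1 + (fun y : En => dot y y)) x != 0 by rewrite fctE gt_eqF ?den_gt0.
have d1 : is_derive x u (cst 1 + (fun y : En => dot y y)) (2 * dot x u).
  by apply: is_derive_eq (is_deriveD (is_derive_cst _ _ _) (DeriveDef (diff_derivable dq) Eq)) _; rewrite add0r.
have [d2 d3] := d1.
have -> : conformal = cst 2 * (fun y : En => ((cst 1 + (fun y : En => dot y y)) y)^-1) by [].
rewrite (deriveM (derivable_cst _ _ _) (derivableV h d2)) derive_cst scaler0 addr0.
rewrite (deriveV h d2) d3 /conformal /GRing.scale /= !fctE -exprVn.
by field; rewrite gt_eqF ?den_gt0.
Qed.

Lemma derive_stereo x u : 'D_u stereo x = dstereo x u.
Proof.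
have ds := smooth_on_differentiable smooth_stereo (I : setT x).
have dc : derivable conformal x u := diff_derivable (smooth_on_differentiable smooth_conformal (I : setT x)).
apply/rowP => j; rewrite (derive_mxE _ _ _ ds).
case: (unliftP ord0 j) => [k ->|->].
  rewrite [RHS]mxE liftK (_ : (fun _ => _) = conformal * (fun x : En => x 0 k)); last first.
    by apply/funext => y; rewrite stereoS.
  have dk : differentiable (fun x : En => x 0 k) x by exact: differentiable_coord.
  rewrite (deriveM dc (diff_derivable dk)) derive_conformal.
  have /= <- := @derive_mxE _ _ _ _ (@id En) x u 0 k (ex_diff).
  by rewrite derive_id /GRing.scale /=; ring.
rewrite [RHS]mxE unlift_none (_ : (fun _ => _) = cst 1 - conformal); last first.
  by apply/funext => y; rewrite stereo0.
by rewrite (deriveB (derivable_cst _ _ _) dc) derive_cst derive_conformal sub0r opprK.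
Qed.

Lemma dstereo_inj x u : dstereo x u = 0 -> u = 0.
Proof.
move=> /rowP H; have c0 := conformal_gt0 x.
have := H 0; rewrite !mxE unlift_none => /eqP.
rewrite mulf_eq0 expf_eq0 (gt_eqF c0) /= => /eqP xu.
apply/rowP => k; have := H (lift ord0 k); rewrite !mxE liftK xu mulr0 mul0r subr0.
by move/eqP; rewrite mulf_eq0 (gt_eqF c0) /= => /eqP.
Qed.

Lemma dstereo_surj x v : tangent (chart x) v -> exists u, dstereo x u = v.
Proof.
rewrite /tangent dot_recl [val _]/= stereo0 => tv; have c0 := conformal_gt0 x.
pose v' : En := \row_k v 0 (lift ord0 k).
have xv : conformal x * dot x v' = - (1 - conformal x) * v 0 0.
  rewrite mulr_sumr (eq_bigr (fun k => stereo x 0 (lift ord0 k) * v 0 (lift ord0 k))).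
    by apply/eqP; rewrite mulNr -addr_eq0 addrC tv.
  by move=> k _; rewrite stereoS mxE mulrA.
(* The first coordinate of the equation determines x . u, the others then u. *)
exists ((conformal x)^-1 *: (v' + v 0 0 *: x)).
have xu : conformal x ^+ 2 * dot x ((conformal x)^-1 *: (v' + v 0 0 *: x)) = v 0 0.
  rewrite dotZr dotDr dotZr.
  transitivity (conformal x * dot x v' + v 0 0 * (conformal x * dot x x)).
    by field; rewrite gt_eqF.
  by rewrite xv conformal_dot; ring.
apply/rowP => j; rewrite mxE; case: (unliftP ord0 j) => [k ->|->].
  by rewrite xu !mxE; field; rewrite gt_eqF.
by rewrite xu.
Qed.

Lemma dstereo_tangent x u : tangent (chart x) (dstereo x u).
Proof.
rewrite /tangent dot_recl [val _]/= stereo0 !mxE unlift_none.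
rewrite (eq_bigr (fun k => conformal x ^+ 2 * (x 0 k * u 0 k) - conformal x ^+ 3 * dot x u * (x 0 k * x 0 k))).
  rewrite sumrB -!mulr_sumr -/(dot x u) -/(dot x x).
  have -> : conformal x ^+ 3 * dot x u * dot x x = conformal x ^+ 2 * dot x u * (conformal x * dot x x) by ring.
  by rewrite conformal_dot; ring.
by move=> k _; rewrite stereoS mxE liftK; ring.
Qed.

Lemma conformal_coord (x : En) k : conformal x * `|x 0 k| <= 1.
Proof.
have h : x 0 k ^+ 2 <= dot x x.
  by rewrite /dot (bigD1 k) //= expr2 lerDl sumr_ge0 // => i _; rewrite -expr2 sqr_ge0.
rewrite /conformal mulrAC ler_pdivrMr ?den_gt0 // mul1r.
have := sqr_ge0 (`|x 0 k| - 1); rewrite -real_normK ?num_real // in h; nra.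
Qed.

Lemma conformal_le2 x : conformal x <= 2.
Proof. by rewrite /conformal ler_pdivrMr ?den_gt0 // ler_peMr // lerDl dot_ge0. Qed.

Lemma conformal_decay (x : En) k (r : R) : 1 <= r -> r <= `|x 0 k| -> conformal x <= 2 / r ^+ 2.
Proof.
move=> r1 rx; have r0 : 0 < r by lra.
have h : x 0 k ^+ 2 <= dot x x.
  by rewrite /dot (bigD1 k) //= expr2 lerDl sumr_ge0 // => i _; rewrite -expr2 sqr_ge0.
rewrite /conformal ler_pM2l // lef_pV2 ?posrE ?den_gt0 ?exprn_gt0 //.
rewrite -real_normK ?num_real // in h.
apply: le_trans (_ : `|x 0 k| ^+ 2 <= _); last by lra.
by rewrite lerXn2r ?nnegrE // ltW.
Qed.

Lemma dstereo_bound (x : En) k i : `|dstereo x (delta_mx 0 k) 0 i| <= 3 * conformal x.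
Proof.
have c0 := conformal_gt0 x; have xk := conformal_coord x k.
have E1 : dot x (delta_mx 0 k) = x 0 k.
  rewrite /dot (bigD1 k) //= big1 => [|j jk]; first by rewrite mxE !eqxx mulr1 addr0.
  by rewrite mxE eqxx (negPf jk) mulr0.
have B1 : `|conformal x ^+ 2 * x 0 k| <= conformal x.
  rewrite normrM (ger0_norm (exprn_ge0 2 (ltW c0))) expr2 -mulrA.
  by apply: ler_piMr (ltW c0) xk.
rewrite mxE E1; case: (unliftP ord0 i) => [j _|_]; last by lra.
apply: le_trans (ler_normB _ _) _.
have -> : 3 * conformal x = conformal x + conformal x * 2 by ring.
apply: lerD.
  rewrite mxE eqxx /= normrM (ger0_norm (ltW c0)); apply: ler_piMr (ltW c0) _.
  by case: eqP => _; rewrite ?normr1 ?normr0 ?ler01.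
have -> : conformal x ^+ 2 * x 0 k * x 0 j = conformal x * (conformal x * (x 0 k * x 0 j)) by ring.
rewrite normrM (ger0_norm (ltW c0)) ler_pM2l //.
have h l : `|x 0 l| ^+ 2 <= dot x x.
  rewrite real_normK ?num_real //.
  by rewrite /dot (bigD1 l) //= expr2 lerDl sumr_ge0 // => i' _; rewrite -expr2 sqr_ge0.
have hd := conformal_dot x; rewrite normrM (ger0_norm (ltW c0)).
apply: (@le_trans _ _ (conformal x * dot x x)); last by rewrite hd; lra.
rewrite ler_pM2l // normrM.
have := h k; have := h j; have := sqr_ge0 (`|x 0 k| - `|x 0 j|); nra.
Qed.

End Stereographic.

(** * The Kaehler form of a strongly integrable structure *)

Section SphereBounds.
Context {R : realType} {n : nat}.
Local Notation E := 'rV[R]_n.+1.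

Lemma compact_sphere : compact [set x : E | dot x x = 1].
Proof.
apply: (@subclosed_compact _ _ (box (fun=> -1) (fun=> 2))).
- rewrite (_ : [set x : E | dot x x = 1] = (fun x : E => dot x x) @^-1` [set 1]) //.
  apply: closed_comp; last exact/accessible_closed_set1/hausdorff_accessible/norm_hausdorff.
  move=> x _; apply: differentiable_continuous.
  apply: (@smooth_on_differentiable _ _ _ setT) => //.
  by apply: smooth_on_dot; [exact: openT|exact: smooth_on_id openT|exact: smooth_on_id openT].
- exact: (@compact_box R n.+1 (fun=> -1) (fun=> 2)).
- move=> x /= x1 i.
  have h : x 0 i ^+ 2 <= 1.
    by rewrite -x1 /dot (bigD1 i) //= expr2 lerDl sumr_ge0 // => k _; rewrite -expr2 sqr_ge0.
  by apply/andP; split; nra.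
Qed.

Lemma sphere_bound m k (F : E -> 'M[R]_(m, k)) : smooth_on punctured F ->
  exists2 B, 0 <= B & forall (p : sphere R n) i j, `|F (val p) i j| <= B.
Proof.
move=> /(smooth_on_mxP open_punctured) sF.
have /choice [b Hb] : forall ij : 'I_m * 'I_k, exists b, 0 <= b /\
    forall p : sphere R n, `|F (val p) ij.1 ij.2| <= b.
  move=> ij; have [|B B0 HB] := @compact_bounded_above _ _ [set x : E | dot x x = 1]
    (fun x => F x ij.1 ij.2) compact_sphere.
    move=> x /= x1; apply: differentiable_continuous.
    apply: smooth_on_differentiable (sF _ _) _; apply/eqP => x0.
    by move: x1; rewrite x0 -(scale0r 0) dotZl mul0r => /eqP; rewrite eq_sym oner_eq0.
  by exists B; split=> // p; apply: HB; exact: sphere_dot.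
exists (\sum_ij b ij); first by apply: sumr_ge0 => ij _; case: (Hb ij).
move=> p i j; apply: le_trans ((Hb (i, j)).2 p) _.
by rewrite (bigD1 (i, j)) //= lerDl sumr_ge0 // => ij _; case: (Hb ij).
Qed.

Lemma mulmx_bound m k l (A : 'M[R]_(m, k)) (B : 'M[R]_(k, l)) (a b : R) :
  (forall i j, `|A i j| <= a) -> (forall i j, `|B i j| <= b) ->
  forall i j, `|(A *m B) i j| <= k%:R * (a * b).
Proof.
move=> Aa Bb i j; rewrite mxE; apply: le_trans (ler_norm_sum _ _ _) _.
apply: (@le_trans _ _ (\sum_(x < k) a * b)); last by rewrite sumr_const card_ord mulr_natl.
by apply: ler_sum => x _; rewrite normrM ler_pM.
Qed.

End SphereBounds.

Section StrongIntegrability.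
Context {R : realType} {n : nat}.
Local Notation S := (sphere R n).
Local Notation E := 'rV[R]_n.+1.
Variables (nabla : (S -> E) -> S -> E -> E) (LC : levi_civita nabla)
  (J : S -> 'M[R]_n.+1) (JC : almost_complex J) (SI : strongly_integrable nabla J).

Definition twistor (p : S) : 'M[R]_(n.+1 + n.+1) := tw_N (val p) (J p).

Lemma unit_row (p : S) : val p *m (val p)^T = 1%:M.
Proof. by rewrite [LHS]mx11_scalar -dotE sphere_dot. Qed.

Lemma tangentP (p : S) v : tangent p v -> val p *m v^T = 0.
Proof. by move=> tv; rewrite [LHS]mx11_scalar -dotE (tv : dot _ _ = 0) raddf0. Qed.

Lemma tangentP' (p : S) v : val p *m v^T = 0 -> tangent p v.
Proof. by move=> h; rewrite /tangent dotE h mxE. Qed.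

Lemma row_J (p : S) : val p *m J p = 0.
Proof. by have [_ /(_ p)[]] := JC. Qed.

Lemma J_col (p : S) : J p *m (val p)^T = 0.
Proof.
apply: mulmx_row_inj => u; rewrite mulmx0 mulmxA -[LHS]trmxK trmx_mul trmxK.
by rewrite (tangentP (J_tangent JC p u)) trmx0.
Qed.

Let Jf : E -> 'M[R]_n.+1 := J \o @radial R n.
Let pf : E -> E := fun x => val (radial x).
Let Kf : E -> 'M[R]_(n.+1 + n.+1, n.+1) := fun x => tw_K (pf x) (Jf x).
Let oP : open (@punctured R n) := open_punctured.

Lemma smooth_on_J : smooth_on punctured Jf.
Proof. by have [sJ _ _] := JC; move/smoothP_mx: sJ. Qed.

Lemma smooth_on_K : smooth_on punctured Kf.
Proof.
have sJ := smooth_on_J; have sP := @smooth_on_tproj R n.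
apply/smooth_on_mxP => // i j; case: (splitP i) => k Ek.
  have -> : i = lshift _ k by apply: val_inj.
  rewrite (_ : (fun _ => _) = fun x => - Jf x k j).
    by apply: smooth_onN => //; move/(smooth_on_mxP oP): sJ.
  by apply/funext => x; rewrite /Kf /tw_K col_mxEu mxE.
have -> : i = rshift _ k by apply: val_inj.
rewrite (_ : (fun _ => _) = fun x => tproj (radial x) k j).
  by move/(smooth_on_mxP oP): sP.
by apply/funext => x; rewrite /Kf /tw_K col_mxEd.
Qed.

Lemma smooth_on_MK :
  smooth_on punctured (fun x => invmx (tw_M (Jf x)) *m (Kf x)^T).
Proof.
have sJ := smooth_on_J.
apply: smooth_on_mulmx => //; last by apply: smooth_on_trmx => //; exact: smooth_on_K.
apply: smooth_on_invmx => // [|x x0].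
  apply: smooth_on_mxD => //; first exact: smooth_on_mxcst.
  by apply: smooth_on_mulmx => //; exact: smooth_on_trmx.
exact: tw_M_unit.
Qed.

Lemma smooth_on_twistor : smooth_on punctured (twistor \o @radial R n).
Proof. by apply: smooth_on_mulmx => //; [exact: smooth_on_K|exact: smooth_on_MK]. Qed.

Lemma derive_K (p : S) v : tangent p v ->
  'D_v Kf (val p) = tw_dK (val p) v (sderive J p v).
Proof.
move=> tv; have p0 := sphere_neq0 p.
have dK := smooth_on_differentiable smooth_on_K p0.
have dJ := smooth_on_differentiable smooth_on_J p0.
have dr := smooth_on_differentiable (@smooth_on_radial R n) p0.
have dP := smooth_on_differentiable (@smooth_on_tproj R n) p0.
have drT : differentiable (fun x => (pf x)^T) (val p).
  by apply: (@smooth_on_differentiable _ _ _ punctured _ _ _ p0); apply: smooth_on_trmx => //; exact: smooth_on_radial.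
have DP : 'D_v (fun x : E => tproj (radial x)) (val p) = - (v^T *m val p + (val p)^T *m v).
  have dq : differentiable (fun x => (pf x)^T *m pf x) (val p).
    apply: (@smooth_on_differentiable _ _ _ punctured _ _ _ p0); apply: smooth_on_mulmx => //; last exact: smooth_on_radial.
    by apply: smooth_on_trmx => //; exact: smooth_on_radial.
  apply: (etrans (deriveB (derivable_cst _ _ _) (diff_derivable dq))).
  rewrite derive_cst sub0r; congr (- _).
  apply: (etrans (derive_mulmx v drT dr)).
  have e1 : 'D_v (fun x => (pf x)^T) (val p) = v^T.
    exact: (etrans (esym (derive_trmx v dr)) (congr1 trmx (derive_radial tv))).
  have e2 : pf (val p) = val p by rewrite /pf radialK.
  exact: (congr2 +%R (congr2 mulmx e1 e2) (congr2 mulmx (congr1 trmx e2) (derive_radial tv))).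
apply/matrixP => i j; apply: (etrans (derive_mxE _ _ _ dK)).
rewrite /tw_dK; case: (splitP i) => k Ek.
  have -> : i = lshift _ k by apply: val_inj.
  have e : sderive J p v k j = 'D_v (fun y => Jf y k j) (val p) := derive_mxE _ _ _ dJ.
  rewrite [RHS]col_mxEu [RHS]mxE e.
  have dk : differentiable (fun y => Jf y k j) (val p) by move/differentiable_mxP: dJ; exact.
  apply: (etrans _ (deriveN (diff_derivable dk))).
  have ef : (fun y => Kf y (lshift _ k) j) = - (fun y => Jf y k j).
    by apply/funext => x; rewrite /Kf /tw_K col_mxEu mxE.
  exact: (congr1 (fun f : E -> R => 'D_v f (val p)) ef).
have -> : i = rshift _ k by apply: val_inj.
rewrite col_mxEd -DP; apply: (etrans _ (esym (derive_mxE _ _ _ dP))).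
have ef : (fun y => Kf y (rshift _ k) j) = (fun y => tproj (radial y) k j).
  by apply/funext => x; rewrite /Kf /tw_K col_mxEd.
exact: (congr1 (fun f : E -> R => 'D_v f (val p)) ef).
Qed.

Lemma derive_twistor (p : S) v : tangent p v -> exists X,
  'D_v (twistor \o @radial R n) (val p) =
   tw_dK (val p) v (sderive J p v) *m (invmx (tw_M (J p)) *m (tw_K (val p) (J p))^T)
   + tw_K (val p) (J p) *m X.
Proof.
move=> tv; have p0 := sphere_neq0 p.
exists ('D_v (fun x => invmx (tw_M (Jf x)) *m (Kf x)^T) (val p)).
apply: (etrans (derive_mulmx v (smooth_on_differentiable smooth_on_K p0)
   (smooth_on_differentiable smooth_on_MK p0))).
by rewrite derive_K // /Kf /Jf /pf /= radialK.
Qed.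

(** The derivative of p *m J p = 0. *)
Lemma derive_row_J (p : S) v : tangent p v -> val p *m sderive J p v = - v *m J p.
Proof.
move=> tv; have p0 := sphere_neq0 p.
have dr := smooth_on_differentiable (@smooth_on_radial R n) p0.
have dJ := smooth_on_differentiable smooth_on_J p0.
have := derive_mulmx v dr dJ.
rewrite (_ : (fun _ => _) = cst 0); last by apply/funext => y; exact: row_J.
rewrite derive_cst derive_radial // /Jf /= radialK => /esym/eqP.
by rewrite addrC addr_eq0 mulNmx => /eqP.
Qed.

Let N := twistor.
Lemma twistor_NN p : N p *m N p = N p.
Proof. exact: (tw_NN (unit_row p) (J_col p)). Qed.

Lemma twistor_NT p : (N p)^T = N p.
Proof. exact: tw_NT. Qed.

Lemma twistor_IN p : tw_I *m N p = N p *m tw_I.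
Proof. exact: (tw_IN (row_J p) (J_sqr JC p)). Qed.

(** By strong integrability the variation along v J is the variation along v
    multiplied by i, so the form is minus the squared norm of a nonzero block. *)
Lemma twistor_form_neq0 (p : S) v : tangent p v -> v != 0 ->
  \tr (tw_I *m N p *m 'D_v (twistor \o @radial R n) (val p)
    *m 'D_(v *m J p) (twistor \o @radial R n) (val p)) != 0.
Proof.
move=> tv v0; have tw := J_tangent JC p v; have p0 := sphere_neq0 p.
have vA : proj_variation (N p) ('D_v (twistor \o @radial R n) (val p)).
  have := @derive_projection_variation _ _ _ punctured oP (twistor \o @radial R n)
    smooth_on_twistor (fun x _ => twistor_NN (radial x)) v (val p) p0.
  by rewrite /= radialK.
have AT : ('D_v (twistor \o @radial R n) (val p))^T = 'D_v (twistor \o @radial R n) (val p).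
  exact: (@derive_projection_sym _ _ _ punctured oP (twistor \o @radial R n)
    smooth_on_twistor (fun x _ => twistor_NT (radial x)) v (val p) p0).
have pdv := derive_row_J tv; have pdw := derive_row_J tw.
apply: (trace_form_neq0 (twistor_NN p) (twistor_IN p) (twistor_NT p) tw_II AT vA).
  apply: (tw_offdiag_J (unit_row p) (row_J p) (J_col p) (J_sqr JC p) (tangentP tv) pdv pdw _
    (derive_twistor tv) (derive_twistor tw)).
  move=> y /tangentP' ty; exact: (strongly_integrable_sderive JC LC SI tv ty).
exact: (tw_offdiag_neq0 (unit_row p) (J_col p) (tangentP tv) (derive_twistor tv) v0).
Qed.

End StrongIntegrability.

Section ChernFormCoordinates.
Context {R : realType} {n m : nat}.
Variables (I : 'M[R]_m) (N : 'rV[R]_n -> 'M[R]_m) (x : 'rV[R]_n) (dN : differentiable N x).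

Lemma chern_form_suml u v :
  chern_form I N u v x = \sum_i u 0 i * chern_form I N (delta_mx 0 i) v x.
Proof.
have e := derive_basis u dN.
apply: (etrans (congr1 (fun A => \tr (I *m N x *m A *m 'D_v N x)) e)).
rewrite mulmx_sumr mulmx_suml (raddf_sum (@mxtrace R m)); apply: eq_bigr => i _.
by rewrite -scalemxAr -scalemxAl; exact: mxtraceZ.
Qed.

Lemma chern_form_sumr u v :
  chern_form I N u v x = \sum_i v 0 i * chern_form I N u (delta_mx 0 i) x.
Proof.
have e := derive_basis v dN.
apply: (etrans (congr1 (fun A => \tr (I *m N x *m 'D_u N x *m A)) e)).
rewrite mulmx_sumr (raddf_sum (@mxtrace R m)); apply: eq_bigr => i _.
by rewrite -scalemxAr; exact: mxtraceZ.
Qed.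

End ChernFormCoordinates.

Section Main.
Context {R : realType}.
Variables (nabla : (sphere R 6 -> 'rV[R]_7) -> sphere R 6 -> 'rV[R]_7 -> 'rV[R]_7)
  (LC : levi_civita nabla) (J : sphere R 6 -> 'M[R]_7) (JC : almost_complex J)
  (SI : strongly_integrable nabla J).
Local Notation E6 := 'rV[R]_6.

Let Nf : 'rV[R]_7 -> 'M[R]_(7 + 7) := twistor J \o @radial R 6.
Definition twistor_chart (x : E6) : 'M[R]_(7 + 7) := twistor J (chart x).
Local Notation Phi := twistor_chart.
Let oT : open (setT : set E6) := openT.

Lemma twistor_chartE x : Phi x = Nf (stereo x).
Proof. by rewrite /Nf /= -[stereo x]/(val (chart x)) radialK. Qed.

Lemma stereo_neq0 (x : E6) : stereo x != 0.
Proof. exact: sphere_neq0 (chart x). Qed.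

Lemma smooth_twistor_chart : smooth_on (setT : set E6) Phi.
Proof.
apply: (@smooth_on_eq _ _ _ _ (fun x => Nf (stereo x))) => //; last first.
  by move=> x _; rewrite twistor_chartE.
apply/smooth_on_mxP => // i j.
apply: (@smooth_on_comp _ _ _ oT _ punctured (fun y => Nf y i j) stereo).
- by have /(smooth_on_mxP open_punctured) := smooth_on_twistor JC; exact.
- by move=> x _; exact: stereo_neq0.
- by move=> k; have /(smooth_on_mxP oT) := @smooth_stereo R 6; exact.
Qed.

Lemma derive_twistor_chart x u : 'D_u Phi x = 'D_(dstereo x u) Nf (stereo x).
Proof.
have -> : Phi = Nf \o stereo by apply/funext => y; exact: twistor_chartE.
have dN := smooth_on_differentiable (smooth_on_twistor JC) (stereo_neq0 x).
have ds := smooth_on_differentiable (@smooth_stereo R 6) (I : setT x).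
by apply: (etrans (derive_chain u ds dN)); rewrite derive_stereo.
Qed.

(** The pullback of the Kaehler form of the Grassmannian, in the chart. *)
Definition kahler (a b : nat) : E6 -> R := chern_form tw_I Phi (axis a) (axis b).

(** The chart is a local diffeomorphism: a kernel vector U has a nonzero tangent
    image v, and v J is the image of a vector of R^6 too. *)
Lemma kahler_nondegenerate x (u : nat -> R) :
  (forall j, (j < 6)%N -> \sum_(i < 6) u i * form_at kahler x i j = 0) ->
  forall i, (i < 6)%N -> u i = 0.
Proof.
move=> ker; have dP := smooth_on_differentiable smooth_twistor_chart (I : setT x).
have ax (i : 'I_6) : axis i = delta_mx 0 i :> E6 by rewrite /axis inord_val.
pose U : E6 := \row_i u i.
suff U0 : U = 0.
  by move=> i i6; have /rowP/(_ (Ordinal i6)) := U0; rewrite !mxE.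
apply: contrapT => /eqP Un0.
have v0 : dstereo x U != 0 by apply: contraNneq Un0 => /dstereo_inj ->.
have tv := dstereo_tangent x U.
have [U' U'E] := dstereo_surj (J_tangent JC (chart x) (dstereo x U)).
have := twistor_form_neq0 LC JC SI tv v0.
rewrite -U'E => /eqP; apply.
suff : chern_form tw_I Phi U U' x = 0.
  by rewrite /chern_form !derive_twistor_chart.
rewrite (chern_form_sumr _ dP) big1 // => j _.
have z : chern_form tw_I Phi U (delta_mx 0 j) x = 0.
  rewrite (chern_form_suml _ dP); apply: (etrans _ (ker j (ltn_ord j))); apply: eq_bigr => i _.
  by rewrite mxE /form_at /kahler !ax.
by rewrite z mulr0.
Qed.

Lemma derive_twistor_chart_bound : exists2 B, 0 <= B &
  forall (x : E6) (k : 'I_6) i j, `|('D_(delta_mx 0 k) Phi x) i j| <= B * conformal x.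
Proof.
have sN := smooth_on_twistor JC.
have /choice [b Hb] : forall l : 'I_7, exists b, 0 <= b /\
    forall (p : sphere R 6) i j, `|('D_(delta_mx 0 l) Nf (val p)) i j| <= b.
  move=> l; have [B B0 HB] := sphere_bound (smooth_on_derive (delta_mx 0 l) sN).
  by exists B.
exists (\sum_l 3 * b l); first by apply: sumr_ge0 => l _; rewrite mulr_ge0 // (Hb l).1.
move=> x k i j.
have dN := smooth_on_differentiable sN (stereo_neq0 x).
have e := etrans (derive_twistor_chart x (delta_mx 0 k)) (derive_basis _ dN).
rewrite (congr1 (fun A : 'M[R]_(7 + 7) => A i j) e) summxE.
apply: le_trans (ler_norm_sum _ _ _) _; rewrite mulr_suml; apply: ler_sum => l _.
rewrite mxE normrM mulrAC; apply: ler_pM => //; first exact: dstereo_bound.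
exact: (Hb l).2 (chart x) i j.
Qed.

(** The form is quadratic in the derivatives of the chart, which are bounded by
    the conformal factor; all other factors are bounded by compactness. *)
Lemma kahler_bound : exists2 K, 0 <= K & forall a b x, `|kahler a b x| <= K * conformal x ^+ 2.
Proof.
have [B1 B10 HB1] := sphere_bound (smooth_on_twistor JC).
have [B2 B20 HB2] := derive_twistor_chart_bound.
pose d : R := (7 + 7)%N%:R.
have d0 : 0 <= d by exact: ler0n.
exists (d * (d * (d * (d * (1 * B1) * B2) * B2))).
  by rewrite !mulr_ge0.
move=> a b x; have c0 := ltW (conformal_gt0 x).
have I1 i j : `|(tw_I : 'M[R]_(7 + 7)) i j| <= 1.
  rewrite /tw_I /block_mx mxE; case: splitP => k _; rewrite mxE; case: splitP => l _;
  rewrite ?mxE ?normr0 ?ler01 //; case: eqP => _;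
  by rewrite ?(mulr0n, mulr1n) ?oppr0 ?normrN ?normr0 ?normr1 ?ler01.
have Phi1 i j : `|Phi x i j| <= B1.
  by rewrite twistor_chartE; exact: (HB1 (chart x)).
have D2 c i j : `|('D_(axis c) Phi x) i j| <= B2 * conformal x by exact: HB2.
have P1 := mulmx_bound I1 Phi1.
have P2 := mulmx_bound P1 (D2 a).
have P3 := mulmx_bound P2 (D2 b).
apply: le_trans (ler_norm_sum _ _ _) _.
apply: le_trans (ler_sum _ (fun i _ => P3 i i)) _.
rewrite sumr_const card_ord -mulr_natl -/d le_eqVlt; apply/orP; left; apply/eqP; ring.
Qed.

Lemma strongly_integrable_contradiction : False.
Proof.
have [K K0 HK] := kahler_bound.
have NN x := twistor_NN JC (chart x).
have NT x := @twistor_NT R 6 J (chart x).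
have IN x := twistor_IN JC (chart x).
have sN := smooth_twistor_chart.
apply: (@no_decaying_symplectic_form R kahler _ _ _ _ (K * 4)).
- move=> a b; exact: smooth_chern_form.
- move=> x a b; exact: (@chern_form_alternating _ _ _ setT oT tw_I Phi sN (fun x _ => IN x) (fun x _ => NT x)
     tw_IT _ _ x I).
- move=> a b c x; exact: (@chern_form_closed _ _ _ setT oT tw_I Phi sN (fun x _ => NN x) (fun x _ => IN x)
     (fun x _ => NT x) tw_IT _ _ _ x I).
- exact: kahler_nondegenerate.
- move=> a b x; apply: le_trans (HK a b x) _; apply: ler_wpM2l => //.
  have := conformal_le2 x; have := ltW (conformal_gt0 x); nra.
- move=> a b x k r r1 rx; apply: le_trans (HK a b x) _.
  rewrite -mulrA; apply: ler_wpM2l => //.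
  have -> : 4 / r ^+ 4 = (2 / r ^+ 2) ^+ 2 by field; rewrite gt_eqF //; lra.
  have := conformal_decay r1 rx; have := ltW (conformal_gt0 x); nra.
Qed.

End Main.

Theorem corollary5p4 (R : realType)
    (nabla : (sphere R 6 -> 'rV[R]_7) -> sphere R 6 -> 'rV[R]_7 -> 'rV[R]_7)
    (nabla_LC : levi_civita nabla) :
  ~ exists J : sphere R 6 -> 'M[R]_7,
      almost_complex J /\ strongly_integrable nabla J.
Proof.
by move=> [J [JC SI]]; case: (strongly_integrable_contradiction nabla_LC JC SI).
Qed.
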